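(* Let $1<p<\infty$ and let $w$ be an $A_p$ weight. Then there exist $A_1$ weights $w_1,w_2$ such that $w=w_1w_2^{1-p}$, $[w_1]_{A_1}\le C_p[w]_{A_p}$ and $[w_2]_{A_1}\le C_p[w]_{A_p}^{1/(p-1)}$, where $C_p$ is a constant depending only on $p$.
   Context: Let $(X,\mathcal{F},\mu)$ be a measure space with a filtration $(\mathcal{F}_n)_{n\ge0}$ (nondecreasing sub-$\sigma$-fields) such that $\sigma(\bigcup_n\mathcal{F}_n)=\mathcal{F}$ and $(X,\mathcal{F}_0,\mu)$ is $\sigma$-finite. A weight is a positive function in $L_1(X)+L_\infty(X)$. For $1<p<\infty$, $[w]_{A_p}=\sup_{n\ge0}\|\mathbb{E}(w|\mathcal{F}_n)\mathbb{E}(w^{1/(1-p)}|\mathcal{F}_n)^{p-1}\|_{L_\infty(X)}$, and $[w]_{A_1}=\sup_{n\ge0}\|\mathbb{E}(w|\mathcal{F}_n)/w\|_{L_\infty(X)}$; $w$ is an $A_p$ (resp. $A_1$) weight if the corresponding characteristic is finite. *)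

(* Defs.v *)
From HB Require Import structures.
From mathcomp Require Import all_boot all_order all_algebra.
From mathcomp Require Import all_classical all_reals all_analysis.
From mathcomp Require Import measurable_realfun lebesgue_measure ess_sup_inf.
Set Implicit Arguments. Unset Strict Implicit. Unset Printing Implicit Defensive.
Import Order.TTheory GRing.Theory Num.Theory.
Local Open Scope classical_set_scope.
Local Open Scope ring_scope.

Section Defs.
Context {d : measure_display} {T : measurableType d} {R : realType}.
Variable mu : {measure set T -> \bar R}.

Definition is_filtration (F : nat -> set (set T)) : Prop :=
  [/\ (forall n, sigma_algebra setT (F n)),
      (forall n, F n `<=` measurable),
      (forall n, F n `<=` F n.+1),
      <<s \bigcup_n F n >> = measurable
    & exists S : nat -> set T,
        (forall k, F 0%N (S k) /\ (mu (S k) < +oo)%E) /\ \bigcup_k S k = setT].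

Definition is_condexp (G : set (set T)) (f g : T -> \bar R) : Prop :=
  [/\ (forall x, (0 <= g x)%E),
      (forall B : set (\bar R), measurable B -> G (g @^-1` B))
    & forall A, G A -> (\int[mu]_(x in A) g x = \int[mu]_(x in A) f x)%E].

Definition is_weight (w : T -> R) : Prop :=
  [/\ (forall x, 0 < w x), measurable_fun setT w
    & exists f g : T -> R,
        [/\ mu.-integrable setT (EFin \o f),
            measurable_fun setT g,
            (exists M : R, {ae mu, forall x, `|g x| <= M})
          & {ae mu, forall x, w x = f x + g x}]].

(* [w]_{A_p} = sup_n || E(w|F_n) E(w^{1/(1-p)}|F_n)^{p-1} ||_infty,
   written as the infimum of all constants K bounding these a.e.
   (+oo if there is no such K). *)
Definition Ap_char (F : nat -> set (set T)) (p : R) (w : T -> R) : \bar R :=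
  ereal_inf [set (K%:E)%E | K in [set K : R | forall n, exists g h : T -> \bar R,
    [/\ is_condexp (F n) (fun x => (w x)%:E) g,
        is_condexp (F n) (fun x => (w x `^ (1 / (1 - p)))%:E) h
      & {ae mu, forall x, (g x * poweR (h x) (p - 1) <= K%:E)%E}]]].

(* [w]_{A_1} = sup_n || E(w|F_n) / w ||_infty. *)
Definition A1_char (F : nat -> set (set T)) (w : T -> R) : \bar R :=
  ereal_inf [set (K%:E)%E | K in [set K : R | forall n, exists g : T -> \bar R,
    is_condexp (F n) (fun x => (w x)%:E) g /\
    {ae mu, forall x, (g x <= (K * w x)%:E)%E}]].

End Defs.

(* Main.v *)
(** The two factors come from one function [v] and the dual weight
    [sigma := w `^ (1 / (1 - p))].  Let [M_rho f := sup_n E^rho(f | F_n)] be the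
    maximal operator of the measure [rho mu].  By Doob's inequality the operators
    [v |-> sigma * M_sigma (v / sigma)] and [v |-> M_w (v^(p-1))^(1/(p-1))] are
    bounded on [L^p(w mu)] with constants depending on [p] only, so an iteration
    in the style of Rubio de Francia yields [v] with
    [eps E^sigma(v / sigma | F_n) <= v / sigma] and
    [eps^(p-1) E^w(v^(p-1) | F_n) <= v^(p-1)], where [eps] depends on [p] only.
    The characteristic of [w] enters only through
    [E(v | F_n) = E^sigma(v / sigma | F_n) E(sigma | F_n)] and
    [E(w v^(p-1) | F_n) = E^w(v^(p-1) | F_n) E(w | F_n)]: conditioning each of the
    two inequalities once more gives
    [E(v | F_n) <= C [w]^(1/(p-1)) v] and [E(w v^(p-1) | F_n) <= C [w] w v^(p-1)].
    The factors are [phi v] and [w (phi v)^(p-1)], where the positive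
    [F_0]-measurable [phi] does not affect the characteristics and makes both
    functions integrable. *)
Require Import Defs.
From HB Require Import structures.
From mathcomp Require Import all_boot all_order all_algebra.
From mathcomp Require Import all_classical all_reals all_analysis.
From mathcomp Require Import measurable_realfun lebesgue_measure ess_sup_inf.
From mathcomp Require Import ring lra.
Set Implicit Arguments. Unset Strict Implicit. Unset Printing Implicit Defensive.
Import Order.TTheory GRing.Theory Num.Theory.
Local Open Scope classical_set_scope.
Local Open Scope ring_scope.

(** * Densities *)

(** The exponents match because sigma^(p-1) = 1/w: the (p-1)-th power of the inequality for v /
    sigma bounds w v^(p-1) from below, which is the function conditioned in the other inequality,
    and a (p-1)-th root leads back. Each A_1 bound thus uses both inequalities and the A_p product
    exactly once. The unweighted maximal operator would instead bring in its norm on L^p(w mu),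
    which depends on [w]. The main obstacle is infinity. Since mu is only sigma-finite on F_0,
    neither w, sigma nor v need be integrable. Conditional expectations therefore take values in
    [0, +oo], and a positive integrable F_0-measurable function psi cuts integrals down before they
    are subtracted. The measures w mu and sigma mu acquire such a psi because the A_p bound makes
    E(w | F_0) and E(sigma | F_0) finite a.e. Moreover conditional expectations are determined only
    a.e., so the iteration increases only a.e., and the limit theorems are proved for such
    sequences. *)

Section density.
Local Open Scope ereal_scope.
Context d (T : measurableType d) (R : realType).
Variables (mu : {measure set T -> \bar R}) (f : T -> \bar R).

(** The proofs [f0] and [mf] are carried by the term so that the measure structure declared below
    can be inferred from it. *)
Definition density (f0 : forall x, 0 <= f x) (mf : measurable_fun setT f)
  (A : set T) : \bar R := \int[mu]_(x in A) f x.

Hypotheses (f0 : forall x, 0 <= f x) (mf : measurable_fun setT f).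
Local Notation nu := (density f0 mf).

Let density0 : nu set0 = 0.
Proof. exact: integral_set0. Qed.

Let density_ge0 A : 0 <= nu A.
Proof. exact: integral_ge0. Qed.

Let density_sigma_additive : semi_sigma_additive nu.
Proof.
move=> /= F mF tF mUF; rewrite /density; apply: cvg_toP.
  apply: ereal_nondecreasing_is_cvgn => m n mn.
  by apply: lee_sum_nneg_natr => // k _ _; apply: integral_ge0.
by rewrite ge0_integral_bigcup//=; exact: measurable_funTS.
Qed.

HB.instance Definition _ := isMeasure.Build _ _ _ nu
  density0 density_ge0 density_sigma_additive.

Import HBNNSimple.

Let integral_density_nnsfun (h : {nnsfun T >-> R}) :
  \int[nu]_x (h x)%:E = \int[mu]_x ((h x)%:E * f x).
Proof.
rewrite integralT_nnsfun sintegralE.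
transitivity (\int[mu]_x
    (\sum_(r \in range h) (r%:E * (\1_(h @^-1` [set r]) x)%:E * f x))).
  rewrite ge0_integral_fsum//; last 2 first.
  - move=> r; apply: emeasurable_funM => //.
    by apply: emeasurable_funM => //; exact/measurable_EFinP.
  - by move=> r x _; rewrite mule_ge0//; exact: nnfun_muleindic_ge0.
  apply: eq_fsbigr => r _.
  have [r0|r0] := ltP r 0%R.
    rewrite preimage_nnfun0// measure0 mule0 integral0_eq// => x _.
    by rewrite indic0 mule0 mul0e.
  have mfr : measurable_fun setT (f \_ (h @^-1` [set r])).
    by apply: (measurable_restrictT f _).1 => //; exact: measurable_funTS.
  transitivity (r%:E * \int[mu]_(x in h @^-1` [set r]) f x) => //.
  rewrite integral_mkcond -ge0_integralZl//; last first.
    by move=> x _; exact: erestrict_ge0.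
  apply: eq_integral => x _; rewrite -muleA; congr (_ * _).
  by rewrite patchE indicE; case: ifP => _; rewrite ?mul1e ?mul0e.
apply: eq_integral => x _.
rewrite -ge0_mule_fsuml; last by move=> r; exact: nnfun_muleindic_ge0.
congr (_ * _); rewrite (fimfunE h) fsbig_finite//= fsbig_finite//=.
by rewrite -sumEFin; apply: eq_bigr.
Qed.

Lemma ge0_integral_density (g : T -> \bar R) :
  (forall x, 0 <= g x) -> measurable_fun setT g ->
  \int[nu]_x g x = \int[mu]_x (g x * f x).
Proof.
move=> g0 mg.
pose g_ := nnsfun_approx measurableT mg.
have cvg_g x : (fun n => (g_ n x)%:E) @ \oo --> g x.
  exact: cvg_nnsfun_approx.
have nd_g x : nondecreasing_seq (fun n => (g_ n x)%:E).
  by move=> m n mn; rewrite lee_fin; exact/lefP/nd_nnsfun_approx.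
have le_g n x : (g_ n x)%:E <= g x.
  by rewrite /g_ nnsfun_approxE; apply: le_approx.
transitivity (limn (fun n => \int[nu]_x (g_ n x)%:E)).
  rewrite -monotone_convergence//.
  - by apply: eq_integral => x _; apply/esym/cvg_lim.
  - by move=> n; exact/measurable_EFinP/measurable_funP.
  - by move=> n x _; rewrite lee_fin.
under eq_fun do rewrite integral_density_nnsfun.
rewrite -monotone_convergence//.
- apply: eq_integral => x _; apply/cvg_lim => //.
  (* The limit of a product must not have the form 0 times infinity, hence the separate treatment of
     the zeros of [g] and of [f]. *)
  have [gx0|gx0] := eqVneq (g x) 0.
    rewrite gx0 mul0e (_ : (fun n => _) = cst 0); first exact: cvg_cst.
    apply/funext => n /=; suff -> : (g_ n x)%:E = 0 by rewrite mul0e.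
    by have := le_g n x; rewrite gx0 => gn0; apply/le_anti; rewrite gn0 lee_fin /=.
  have [fx0|fx0] := eqVneq (f x) 0.
    by rewrite fx0 mule0; under eq_fun do rewrite mule0; exact: cvg_cst.
  apply: cvgeM => //; last exact: cvg_cst.
  by rewrite mule_defE (negbTE gx0) (negbTE fx0).
- move=> n; apply: emeasurable_funM => //.
  exact/measurable_EFinP/measurable_funP.
- by move=> n x _; rewrite mule_ge0// lee_fin.
- by move=> x _ m n mn; apply: lee_wpmul2r => //; exact: nd_g.
Qed.

End density.

(** * Measurability with respect to a sub-sigma-algebra *)

(** Stated on [T] equipped with the sigma-algebra generated by [G], so that the general closure
    properties of measurable functions apply; [submeasP] recovers the preimage form of
    [is_condexp]. *)
Definition submeas {T : pointedType} {R : realType} (G : set (set T))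
  (g : T -> \bar R) : Prop :=
  measurable_fun [set: g_sigma_algebraType G] (g : g_sigma_algebraType G -> \bar R).

Section submeas.
Context d (T : measurableType d) (R : realType).
Implicit Types (G : set (set T)) (g : T -> \bar R).

Lemma submeasP G g : sigma_algebra setT G ->
  submeas G g <-> (forall B, measurable B -> G (g @^-1` B)).
Proof.
move=> sG; split=> [mg B mB|mg _ B mB].
  by rewrite -(sigma_algebra_id sG); have := mg measurableT B mB; rewrite setTI.
by rewrite setTI; rewrite /measurable/= (sigma_algebra_id sG); exact: mg.
Qed.

Lemma submeas_measurable G g : sigma_algebra setT G -> G `<=` measurable ->
  submeas G g -> measurable_fun setT g.
Proof.
by move=> sG GM /(submeasP g sG) mg _ B mB; rewrite setTI; exact/GM/mg.
Qed.

Lemma submeasS G1 G2 g : sigma_algebra setT G1 -> sigma_algebra setT G2 ->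
  G1 `<=` G2 -> submeas G1 g -> submeas G2 g.
Proof.
move=> s1 s2 G12 /(submeasP g s1) mg; apply/(submeasP g s2) => B mB.
exact/G12/mg.
Qed.

Lemma submeas_set G (A : set T) : sigma_algebra setT G ->
  measurable (A : set (g_sigma_algebraType G)) -> G A.
Proof. by move=> sG; rewrite /measurable/= (sigma_algebra_id sG). Qed.

Lemma set_submeas G (A : set T) : 
  G A -> measurable (A : set (g_sigma_algebraType G)).
Proof. by move=> GA; apply: sub_sigma_algebra. Qed.

Lemma submeas_lt G g g' : sigma_algebra setT G -> submeas G g -> submeas G g' ->
  G [set x | (g x < g' x)%E].
Proof.
move=> sG mg mg'; apply: (submeas_set sG).
by rewrite -[X in measurable X]setTI; apply: measurable_lte.
Qed.

Lemma submeas_le G g g' : sigma_algebra setT G -> submeas G g -> submeas G g' ->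
  G [set x | (g x <= g' x)%E].
Proof.
move=> sG mg mg'; apply: (submeas_set sG).
by rewrite -[X in measurable X]setTI; apply: measurable_lee.
Qed.

Lemma submeasM G g g' : submeas G g -> submeas G g' ->
  submeas G (fun x => g x * g' x)%E.
Proof. exact: emeasurable_funM. Qed.

Lemma submeas_poweR G g r : submeas G g -> submeas G (fun x => poweR (g x) r).
Proof. exact: (measurableT_comp (measurable_poweR r)). Qed.

Lemma submeas_cst G (r : \bar R) : submeas G (fun _ : T => r).
Proof. exact: measurable_cst. Qed.

End submeas.

(** * Restriction of a measure to a sub-sigma-algebra *)

Section trace.
Local Open Scope ereal_scope.
Context d (T : measurableType d) (R : realType).
Variables (nu : {measure set T -> \bar R}) (G : set (set T)).

Definition trace (sG : sigma_algebra setT G) (GM : G `<=` measurable)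
  (A : set (g_sigma_algebraType G)) : \bar R := nu A.

Hypotheses (sG : sigma_algebra setT G) (GM : G `<=` measurable).

Let measurable_trace (A : set (g_sigma_algebraType G)) :
  measurable A -> measurable (A : set T).
Proof. by move=> /(submeas_set sG)/GM. Qed.

Let trace0 : trace sG GM set0 = 0. Proof. exact: measure0. Qed.

Let trace_ge0 A : 0 <= trace sG GM A. Proof. exact: measure_ge0. Qed.

Let trace_sigma_additive : semi_sigma_additive (trace sG GM).
Proof.
move=> F mF tF mUF; apply: (@measure_semi_sigma_additive _ _ _ nu) => //.
- by move=> i; exact: measurable_trace.
- exact: measurable_trace.
Qed.

HB.instance Definition _ := isMeasure.Build _ _ _ (trace sG GM)
  trace0 trace_ge0 trace_sigma_additive.

(** By [GM] the identity from [T] to [T] with the sigma-algebra [G] is measurable, and the trace is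
    the pushforward of [nu] along it. *)
Lemma ge0_integral_trace (g : T -> \bar R) (A : set T) : G A ->
  (forall x, 0 <= g x) -> submeas G g ->
  \int[trace sG GM]_(x in A) g x = \int[nu]_(x in A) g x.
Proof.
move=> GA g0 mg.
have mid : measurable_fun [set: T] (id : T -> g_sigma_algebraType G).
  by move=> _ B mB; rewrite setTI; exact: measurable_trace.
have <- := @ge0_integral_pushforward _ _ _ _ R _ mid nu A g _ _ _.
- by apply: eq_measure_integral => B mB _.
- exact: set_submeas.
- exact: measurable_funTS.
- by move=> x _; exact: g0.
Qed.

End trace.

(** * Conditional expectation *)

(* Equivalent to sigma-finiteness of [nu] on [G], without exhausting sequences. *)
Definition sigma_fin {d} {T : measurableType d} {R : realType}
    (nu : {measure set T -> \bar R}) (G : set (set T)) : Prop :=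
  exists psi : T -> R, [/\ forall x, 0 < psi x, submeas G (EFin \o psi)
    & (\int[nu]_x (psi x)%:E < +oo)%E].

Section ae_comparison.
Local Open Scope ereal_scope.
Context d (T : measurableType d) (R : realType).
Variable (nu : {measure set T -> \bar R}).

Lemma integral_le0_negligible (A : set T) (h : T -> \bar R) :
  measurable A -> measurable_fun A h -> (forall x, A x -> 0 < h x) ->
  \int[nu]_(x in A) h x <= 0 -> nu.-negligible A.
Proof.
move=> mA mh h0 ih.
have ih0 : \int[nu]_(x in A) `|h x| = 0.
  apply/le_anti; rewrite integral_ge0 ?andbT//.
  rewrite (@eq_integral _ _ _ nu _ h)// => x /[!inE] Ax.
  by rewrite gee0_abs// ltW// h0.
have /(ae_eq_integral_abs nu mA mh) := ih0.
apply: negligibleS => x Ax /=; apply/not_implyP; split => //.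
by apply/eqP; rewrite gt_eqF// h0.
Qed.

Variables (G : set (set T)).
Hypotheses (sG : sigma_algebra setT G) (GM : G `<=` measurable).
Hypothesis sfG : sigma_fin nu G.

(** The set where [g' < g] is exhausted by its parts [A k] where also [g' <= k psi]. There [g'] has
    finite integral, so it can be subtracted, and the positive difference [g - g'] has integral at
    most 0. *)
Lemma submeas_le_ae (g g' : T -> \bar R) :
  (forall x, 0 <= g x) -> (forall x, 0 <= g' x) ->
  submeas G g -> submeas G g' ->
  (forall A, G A -> \int[nu]_(x in A) g x <= \int[nu]_(x in A) g' x) ->
  {ae nu, forall x, g x <= g' x}.
Proof.
move=> g0 g'0 mg mg' gg'; have [psi [psi0 mpsi ipsi]] := sfG.
pose A k := [set x | g' x < g x] `&` [set x | g' x <= (k%:R * psi x)%:E].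
have mkpsi k : submeas G (fun x => (k%:R * psi x)%:E).
  by under eq_fun do rewrite EFinM; apply: submeasM => //; exact: submeas_cst.
have GA k : G (A k).
  apply: (submeas_set sG); apply: measurableI; apply: set_submeas.
    exact: submeas_lt.
  exact: submeas_le.
have Tmg := submeas_measurable sG GM mg.
have Tmg' := submeas_measurable sG GM mg'.
have Tmpsi := submeas_measurable sG GM mpsi.
suff : nu.-negligible (\bigcup_k A k).
  apply: negligibleS => x /= /negP; rewrite -ltNge => gx.
  have g'x : g' x \is a fin_num.
    by rewrite ge0_fin_numE//; apply: (lt_le_trans gx); exact: leey.
  exists (Num.truncn (fine (g' x) / psi x)).+1 => //; split => //=.
  rewrite -(fineK g'x) lee_fin -ler_pdivrMr//.
  exact/ltW/truncnS_gt.
apply: negligible_bigcup => k; have mA := GM (GA k).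
have ig' : \int[nu]_(x in A k) g' x < +oo.
  apply: le_lt_trans (_ : k%:R%:E * \int[nu]_x (psi x)%:E < _); last first.
    by rewrite lte_mul_pinfty// ?lee_fin.
  rewrite -ge0_integralZl//; last by move=> x _; rewrite lee_fin ltW.
  apply: le_trans (_ : \int[nu]_(x in A k) (k%:R%:E * (psi x)%:E) <= _).
    apply: ge0_le_integral => //.
    - exact: measurable_funTS.
    - by apply: measurable_funTS; apply: emeasurable_funM.
    - by move=> x [_].
  apply: ge0_subset_integral => //.
    by apply: emeasurable_funM.
  by move=> x _; rewrite mule_ge0// lee_fin// ltW.
have g'fin x : A k x -> g' x \is a fin_num.
  by move=> [_ /= g'k]; rewrite ge0_fin_numE// (le_lt_trans g'k)// ltry.
apply: (@integral_le0_negligible _ (fun x => g x - g' x)) => //.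
- by apply: measurable_funTS; apply: emeasurable_funB.
- by move=> x Ax; rewrite sube_gt0//; case: Ax.
have ig'f : \int[nu]_(x in A k) g' x \is a fin_num.
  by rewrite ge0_fin_numE// integral_ge0.
have gE : \int[nu]_(x in A k) g x =
    \int[nu]_(x in A k) g' x + \int[nu]_(x in A k) (g x - g' x).
  rewrite -ge0_integralD//; last 3 first.
  - exact: measurable_funTS.
  - by move=> x Ax; rewrite sube_ge0 ?g'fin// ltW//; case: Ax.
  - by apply: measurable_funTS; apply: emeasurable_funB.
  by apply: eq_integral => x /[!inE] Ax; rewrite addeC subeK// g'fin.
have := gg' _ (GA k); by rewrite gE -[leRHS]adde0 leeD2lE.
Qed.

End ae_comparison.

Section condexp.
Local Open Scope ereal_scope.
Context d (T : measurableType d) (R : realType).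
Variables (nu : {measure set T -> \bar R}) (G : set (set T)).
Hypotheses (sG : sigma_algebra setT G) (GM : G `<=` measurable).

(** The measures with densities [f] and [g] have the same trace on [G], and the integral of a
    [G]-measurable function depends on that trace only. No integrability is involved. *)
Lemma condexp_pullout (f g phi : T -> \bar R) :
  (forall x, 0 <= f x) -> measurable_fun setT f ->
  is_condexp nu G f g -> (forall x, 0 <= phi x) -> submeas G phi ->
  \int[nu]_x (phi x * g x) = \int[nu]_x (phi x * f x).
Proof.
move=> f0 mf [g0 mg fg] phi0 mphi.
have Tmphi := submeas_measurable sG GM mphi.
have Tmg := submeas_measurable sG GM ((submeasP g sG).2 mg).
rewrite -(ge0_integral_density nu f0 mf phi0 Tmphi).
rewrite -(ge0_integral_density nu g0 Tmg phi0 Tmphi).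
have GT : G setT by rewrite -(sigma_algebra_id sG); exact: (@measurableT _ (g_sigma_algebraType G)).
rewrite -(ge0_integral_trace (density nu g0 Tmg) sG GM GT phi0 mphi).
rewrite -(ge0_integral_trace (density nu f0 mf) sG GM GT phi0 mphi).
by apply: eq_measure_integral => A /(submeas_set sG) GA _; exact: fg.
Qed.

Hypothesis sfG : sigma_fin nu G.

(** The level sets where [psi >= 1 / (k + 1)] exhaust the space and have finite measure by Markov's
    inequality. *)
Let sigma_finite_trace : sigma_finite setT (trace nu sG GM).
Proof.
have [psi [psi0 mpsi ipsi]] := sfG.
exists (fun k => [set x | (k.+1%:R^-1)%:E <= (psi x)%:E]).
  apply/seteqP; split=> // x _; exists (Num.truncn (psi x)^-1) => //=.
  by rewrite lee_fin invf_ple ?posrE// ltW// truncnS_gt.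
move=> k; set A := [set x | _].
have GA : G A by apply: submeas_le => //; exact: submeas_cst.
split; first exact: set_submeas.
have Tmpsi := submeas_measurable sG GM mpsi.
have TA : measurable (A : set T) by exact: GM.
rewrite /trace -(mul1e (nu A)) -integral_cst//.
apply: (@le_lt_trans _ _ (k.+1%:R%:E * \int[nu]_x (psi x)%:E)); last first.
  by rewrite lte_mul_pinfty// ?lee_fin.
rewrite -ge0_integralZl//; last by move=> x _; rewrite lee_fin ltW.
apply: le_trans (_ : \int[nu]_(x in A) (k.+1%:R%:E * (psi x)%:E) <= _).
  apply: ge0_le_integral => //.
  - by apply: measurable_funTS; apply: emeasurable_funM.
  - move=> x; rewrite /A/= lee_fin => kx; rewrite -EFinM lee_fin.
    by rewrite -ler_pdivrMl// mulr1.
apply: ge0_subset_integral => //.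
  by apply: emeasurable_funM.
by move=> x _; rewrite mule_ge0// lee_fin// ltW.
Qed.

(** Radon-Nikodym derivative of the trace of [f nu] with respect to the trace of [nu]. *)
Let condexp_integrable (f : T -> \bar R) :
  (forall x, 0 <= f x) -> measurable_fun setT f -> \int[nu]_x f x < +oo ->
  exists g, is_condexp nu G f g.
Proof.
move=> f0 mf iff.
pose m : {measure set (g_sigma_algebraType G) -> \bar R} := trace nu sG GM.
pose n : {measure set (g_sigma_algebraType G) -> \bar R} :=
  trace (density nu f0 mf) sG GM.
have fin_n : fin_num_fun n by apply: lty_fin_num_fun.
pose m' : {sigma_finite_measure set (g_sigma_algebraType G) -> \bar R} :=
  HB.pack (m : set _ -> \bar R) (Measure.class m) (Measure_isSigmaFinite.Build _ _ _ m sigma_finite_trace).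
pose n' : {finite_measure set (g_sigma_algebraType G) -> \bar R} :=
  HB.pack (n : set _ -> \bar R) (Measure.class n) (Measure_isFinite.Build _ _ _ n fin_n).
have nm : n' `<< m'.
  apply/null_content_dominatesP => A /(submeas_set sG) GA mA0.
  have mA : measurable (A : set T) by exact: GM.
  have -> : n' A = \int[nu]_(x in A) f x by [].
  rewrite -(integral_abs_eq0 mA (measurable_funTS mf) mA0).
  by apply: eq_integral => x _; rewrite gee0_abs.
have [g [g0 gfin ig gE]] := radon_nikodym_sigma_finite nm.
have mg : submeas G g by exact: measurable_int ig.
exists g; split=> //; first exact/(submeasP _ sG).
move=> A GA; rewrite -(ge0_integral_trace nu sG GM GA g0 mg).
by rewrite -(gE _ (set_submeas GA)).
Qed.

(** As [psi > 0], [f] is the sum of the increments [e N] of the truncations [min(f, N psi)], also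
    where it is infinite. Each increment is integrable, and the conditional expectations are added
    up. *)
Lemma condexp_exists (f : T -> \bar R) :
  (forall x, 0 <= f x) -> measurable_fun setT f ->
  exists g, is_condexp nu G f g.
Proof.
move=> f0 mf; have [psi [psi0 mpsi ipsi]] := sfG.
have Tmpsi := submeas_measurable sG GM mpsi.
pose fr N x := fine (mine (f x) (N%:R * psi x)%:E).
have frE N x : (fr N x)%:E = mine (f x) (N%:R * psi x)%:E.
  rewrite fineK// ge0_fin_numE.
    by rewrite gt_min ltry orbT.
  by rewrite le_min f0 lee_fin mulr_ge0// ltW.
have nd_fr x m n : (m <= n)%N -> (fr m x <= fr n x)%R.
  move=> mn; rewrite -lee_fin !frE le_min ge_min lexx/= ge_min.
  by rewrite !lee_fin ler_wpM2r ?orbT// ?ler_nat// ltW.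
have mfr N : measurable_fun setT (fun x => (fr N x)%:E).
  under eq_fun do rewrite frE.
  apply: measurable_mine => //; under eq_fun do rewrite EFinM.
  exact: emeasurable_funM.
pose e N x := (fr N.+1 x - fr N x)%:E.
have e0 N x : 0 <= e N x by rewrite lee_fin subr_ge0 nd_fr.
have me N : measurable_fun setT (e N).
  by rewrite /e; under eq_fun do rewrite EFinB; exact: emeasurable_funB.
have fr0 N x : (0 <= fr N x)%R.
  by rewrite fine_ge0// le_min f0 lee_fin mulr_ge0// ltW.
have ie N : \int[nu]_x e N x < +oo.
  apply: (@le_lt_trans _ _ (N.+1%:R%:E * \int[nu]_x (psi x)%:E)); last first.
    by rewrite lte_mul_pinfty// ?lee_fin.
  rewrite -ge0_integralZl//; last by move=> x _; rewrite lee_fin ltW.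
  apply: ge0_le_integral => //.
  - by apply: emeasurable_funM.
  - move=> x _; apply: (@le_trans _ _ (fr N.+1 x)%:E).
      by rewrite lee_fin gerBl.
    by rewrite frE -EFinM ge_min lexx orbT.
have fE x : f x = \sum_(N <oo) e N x.
  apply/esym/cvg_lim => //.
  rewrite (_ : (fun n => _) = (fun n => (fr n x)%:E)); last first.
    apply/funext => n; rewrite /e sumEFin telescope_sumr//.
    rewrite (_ : fr 0%N x = 0%R) ?subr0//.
    by apply/EFin_inj; rewrite frE mul0r; apply/min_idPr.
  case E : (f x) (f0 x) => [r| |] // _.
    apply: cvg_near_cst; near=> n; rewrite frE E; apply/min_idPl.
    rewrite lee_fin -ler_pdivrMr//; near: n; exact: nbhs_infty_ger.
  rewrite (_ : (fun n => _) = (fun n => (n%:R * psi x)%:E)); last first.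
    by apply/funext => n; rewrite frE E; apply/min_idPr; rewrite leey.
  apply/cvgeryP/cvgryPge => a; near=> n.
  rewrite -ler_pdivrMr//; near: n; exact: nbhs_infty_ger.
have /choice[g gP] N : exists g, is_condexp nu G (e N) g.
  exact: condexp_integrable.
have g0 N x : 0 <= g N x by have [] := gP N.
have mg N : submeas G (g N) by have [_ /(submeasP _ sG)] := gP N.
exists (fun x => \sum_(N <oo) g N x); split.
- by move=> x; apply: nneseries_ge0.
- apply/(submeasP _ sG).
  by apply: (@ge0_emeasurable_sum _ (g_sigma_algebraType G) R setT g xpredT) => // n _; exact: mg.
- move=> A GA; have mA : measurable (A : set T) by exact: GM.
  under [RHS]eq_integral do rewrite fE.
  rewrite !integral_nneseries//.
  + by apply: eq_eseriesr => N _; have [_ _] := gP N; exact.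
  + by move=> N; exact: measurable_funTS.
  + by move=> N; apply: measurable_funTS; exact: submeas_measurable (mg N).
Unshelve. all: by end_near. Qed.

End condexp.

(** * Powers, suprema, and monotone convergence for a.e. increasing sequences *)

Section ereal_sup_lemmas.
Local Open Scope ereal_scope.
Context (R : realType).

Lemma le_poweR2r (r : R) (x y : \bar R) : (0 <= r)%R -> 0 <= x -> x <= y ->
  poweR x r <= poweR y r.
Proof.
move=> r0 x0 xy; apply: gt0_ler_poweR => //; rewrite in_itv/= leey andbT//.
exact: le_trans xy.
Qed.

Lemma poweRK (r : R) (x : \bar R) : r != 0%R -> 0 <= x ->
  poweR (poweR x r) r^-1 = x.
Proof. by move=> r0 x0; rewrite -poweRrM mulfV// poweRe1. Qed.

Lemma poweRVK (r : R) (x : \bar R) : r != 0%R -> 0 <= x ->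
  poweR (poweR x r^-1) r = x.
Proof. by move=> r0 x0; rewrite -poweRrM mulVf// poweRe1. Qed.

(** The power map is an order isomorphism of [0, +oo], with inverse the power [r^-1]. *)
Lemma poweR_ereal_sup (r : R) (u : nat -> \bar R) : (0 < r)%R ->
  (forall k, 0 <= u k) ->
  poweR (ereal_sup (range u)) r = ereal_sup (range (fun k => poweR (u k) r)).
Proof.
move=> r0 u0; have rn0 : r != 0%R by rewrite gt_eqF.
have su : 0 <= ereal_sup (range u).
  by apply: (le_trans (u0 0%N)); apply: ereal_sup_ubound; exists 0%N.
have sp : 0 <= ereal_sup (range (fun k => poweR (u k) r)).
  by apply: (le_trans (poweR_ge0 (u 0%N) r)); apply: ereal_sup_ubound; exists 0%N.
apply/le_anti/andP; split.
  rewrite -[leRHS](poweRVK rn0)//; apply: le_poweR2r => //; first exact: ltW.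
  apply: ge_ereal_sup => _ [k _ <-]; rewrite -(poweRK rn0 (u0 k)).
  apply: le_poweR2r; first by rewrite invr_ge0 ltW.
    exact: poweR_ge0.
  by apply: ereal_sup_ubound; exists k.
apply: ge_ereal_sup => _ [k _ <-]; apply: le_poweR2r => //; first exact: ltW.
by apply: ereal_sup_ubound; exists k.
Qed.

Lemma ge0_mule_ereal_sup (c : R) (u : nat -> \bar R) : (0 < c)%R ->
  c%:E * ereal_sup (range u) = ereal_sup (range (fun k => c%:E * u k)).
Proof.
move=> c0; apply/le_anti/andP; split; last first.
  apply: ge_ereal_sup => _ [k _ <-]; rewrite lee_pmul2l//.
  by apply: ereal_sup_ubound; exists k.
rewrite muleC -lee_pdivlMr//; apply: ge_ereal_sup => _ [k _ <-].
by rewrite lee_pdivlMr// muleC; apply: ereal_sup_ubound; exists k.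
Qed.

End ereal_sup_lemmas.

Section ae_monotone_convergence.
Local Open Scope ereal_scope.
Context d (T : measurableType d) (R : realType).

Lemma measurable_fun_ereal_sup (D : set T) (f : nat -> T -> \bar R) :
  (forall n, measurable_fun D (f n)) ->
  measurable_fun D (fun x => ereal_sup (range (f ^~ x))).
Proof.
move=> mf; have := measurable_fun_esups mf 0%N.
congr measurable_fun; apply/funext => x; congr ereal_sup.
by apply/seteqP; split => [_ [k _ <-]|_ [k _ <-]]; exists k.
Qed.

Variable mu : {measure set T -> \bar R}.

(** The running maxima [g] increase everywhere, have the same supremum as [f] and agree with [f]
    a.e., so ordinary monotone convergence applies to them. *)
Lemma ae_ge0_integral_ereal_sup (A : set T) (f : nat -> T -> \bar R) :
  measurable A -> (forall n x, 0 <= f n x) ->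
  (forall n, measurable_fun setT (f n)) ->
  (forall n, {ae mu, forall x, f n x <= f n.+1 x}) ->
  \int[mu]_(x in A) ereal_sup (range (f ^~ x)) =
  ereal_sup (range (fun n => \int[mu]_(x in A) f n x)).
Proof.
move=> mA f0 mf ndf.
pose g := fix g n x := if n is n'.+1 then maxe (g n' x) (f n x) else f 0%N x.
have gS n x : g n x <= g n.+1 x by rewrite /= le_max lexx.
have ndg x : nondecreasing_seq (g ^~ x) by apply/nondecreasing_seqP => n.
have fg n x : f n x <= g n x by case: n => [|n]//=; rewrite le_max lexx orbT.
have g0 n x : 0 <= g n x by apply: le_trans (fg n x).
have mg n : measurable_fun setT (g n).
  by elim: n => [|n ih]//=; apply: measurable_maxe.
have gf n x : g n x <= ereal_sup (range (f ^~ x)).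
  elim: n => [|n ih] /=; first by apply: ereal_sup_ubound; exists 0%N.
  by rewrite ge_max ih; apply: ereal_sup_ubound; exists n.+1.
have gfae n : \int[mu]_(x in A) g n x = \int[mu]_(x in A) f n x.
  apply: ge0_ae_eq_integral => //; [exact: measurable_funTS..|].
  have := ae_foralln ndf; apply: filterS => x ndx _.
  by elim: n => [|n ih]//=; rewrite ih; apply/max_idPr.
have supE x : ereal_sup (range (f ^~ x)) = limn (g ^~ x).
  have /cvg_lim -> := ereal_nondecreasing_cvgn (ndg x); last by [].
  apply/le_anti/andP; split; apply: ge_ereal_sup => _ [k _ <-] //.
  by apply: (le_trans (fg k x)); apply: ereal_sup_ubound; exists k.
under eq_integral do rewrite supE.
rewrite monotone_convergence//; last by move=> n; exact: measurable_funTS.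
under eq_fun do rewrite gfae.
apply/cvg_lim => //; apply: ereal_nondecreasing_cvgn.
apply/nondecreasing_seqP => n; rewrite -!gfae; apply: ge0_le_integral => //.
- exact: measurable_funTS.
- exact: measurable_funTS.
Qed.

End ae_monotone_convergence.

(** * Doob's maximal inequality *)

Section doob_scalar.
Context (R : realType).
Implicit Types q x y c : R.

Lemma powR_sub_le q x y : 1 < q -> 0 <= y -> y <= x ->
  x `^ q - y `^ q <= q / (q - 1) * (x * (x `^ (q - 1) - y `^ (q - 1))).
Proof.
move=> q1 y0 yx; have x0 := le_trans y0 yx.
have q0 : 0 < q by lra.
have qm0 : 0 < q - 1 by lra.
have := @conjugate_powR R x (y `^ (q - 1)) q (q / (q - 1)) x0 (powR_ge0 _ _).
have -> : (y `^ (q - 1)) `^ (q / (q - 1)) = y `^ q.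
  by rewrite -powRrM mulrC divfK// gt_eqF.
move=> /(_ q0); rewrite divr_gt0// => /(_ isT).
have e1 : q^-1 + (q / (q - 1))^-1 = 1 by field; rewrite !gt_eqF.
move=> /(_ e1) young.
rewrite mulrBr mulr_powRB1//.
have : q / (q - 1) * (x * y `^ (q - 1)) <= x `^ q / (q - 1) + y `^ q.
  apply: le_trans (ler_wpM2l _ young) _; first by rewrite divr_ge0// ltW.
  by rewrite le_eqVlt; apply/orP; left; apply/eqP; field; rewrite !gt_eqF.
suff : q / (q - 1) * x `^ q = x `^ q + x `^ q / (q - 1) by nra.
by field; rewrite gt_eqF.
Qed.

(** If [2 c y <= x] the first term on the right suffices, otherwise the second. The coefficient 1/2
    lets the power of [x] be absorbed on the left of Doob's inequality. *)
Lemma powR_absorb q c x y : 1 < q -> 0 < c -> 0 <= x -> 0 <= y ->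
  c * (x `^ (q - 1) * y) <= 2^-1 * x `^ q + c * (2 * c) `^ (q - 1) * y `^ q.
Proof.
move=> q1 c0 x0 y0; have q0 : 0 < q by lra.
have [cyx|xcy] := leP (2 * c * y) x.
  have h : 0 <= c * (2 * c) `^ (q - 1) * y `^ q.
    by rewrite !mulr_ge0// ?powR_ge0// ltW.
  rewrite -(mulr_powRB1 x0 q0).
  have := powR_ge0 x (q - 1); nra.
have h : 0 <= 2^-1 * x `^ q by rewrite mulr_ge0// ?powR_ge0.
apply: le_trans (_ : c * (2 * c) `^ (q - 1) * y `^ q <= _); last by lra.
rewrite -(mulr_powRB1 y0 q0) -!mulrA ler_wpM2l//; first exact: ltW.
rewrite mulrCA [leLHS]mulrC ler_wpM2l// -powRM//; last by lra.
rewrite ge0_ler_powR ?nnegrE//; first by lra.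
- by rewrite !mulr_ge0// ltW.
- exact: ltW.
Qed.

End doob_scalar.

(** For q > 1 this equals (2q / (q - 1))^q, that is 2^q times the classical constant of Doob's L^q
    inequality. The outer factor 2 comes from absorbing one half, the rest from [powR_absorb]. *)
Definition doob_const {R : realType} (q : R) : R :=
  let c := q / (q - 1) in 2 * (c * (2 * c) `^ (q - 1)).

Lemma doob_const_gt0 {R : realType} (q : R) : 1 < q -> 0 < doob_const q.
Proof.
move=> q1; rewrite /doob_const.
have c0 : 0 < q / (q - 1) by rewrite divr_gt0; lra.
move: (q / (q - 1)) c0 => c c0.
by rewrite !mulr_gt0// powR_gt0// mulr_gt0.
Qed.

(** * Doob's inequality for a bounded running maximum *)

Section doob_truncated.
Local Open Scope ereal_scope.
Context d (T : measurableType d) (R : realType).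
Variables (nu : {measure set T -> \bar R}) (F : nat -> set (set T)).
Hypotheses (sF : forall n, sigma_algebra setT (F n))
  (FM : forall n, F n `<=` measurable) (FS : forall n, F n `<=` F n.+1).
Variables (q : R) (f : T -> \bar R) (s : nat -> T -> \bar R).
Hypotheses (q1 : (1 < q)%R) (f0 : forall x, 0 <= f x)
  (mf : measurable_fun setT f) (sP : forall n, is_condexp nu (F n) f (s n)).
(* [m n.+1] stands for the truncated maximum of [s 0], ..., [s n], and [m 0] is a
   dummy initial value. *)
Variables (m : nat -> T -> R) (K : R).
Hypotheses (m_zero : forall x, m 0%N x = 0%R) (m0 : forall n x, (0 <= m n x)%R)
  (mK : forall n x, (m n x <= K)%R) (nd_m : forall n x, (m n x <= m n.+1 x)%R)
  (mm : forall n, submeas (F n) (fun x => (m n.+1 x)%:E))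
  (m_jump : forall n x, m n.+1 x = m n x \/ (m n.+1 x)%:E <= s n x).

Let s0 n x : 0 <= s n x. Proof. by have [] := sP n. Qed.
Let ms n : submeas (F n) (s n).
Proof. by have [_ /(submeasP _ (sF n))] := sP n. Qed.

Let subS n (g : T -> \bar R) : submeas (F n) g -> submeas (F n.+1) g.
Proof. exact: submeasS (sF n) (sF n.+1) (@FS n). Qed.

Let mmp n (r : R) : submeas (F n) (fun x => (m n x `^ r)%:E).
Proof.
apply: (@submeas_poweR _ T R (F n) (fun x => (m n x)%:E) r).
case: n => [|n]; first by under eq_fun do rewrite m_zero; exact: measurable_cst.
exact: subS (@mm n).
Qed.

Let mmpS n (r : R) : submeas (F n) (fun x => (m n.+1 x `^ r)%:E).
Proof.
exact: (@submeas_poweR _ T R (F n) (fun x => (m n.+1 x)%:E) r (@mm n)).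
Qed.

Let q0 : (0 < q)%R. Proof. exact: lt_trans ltr01 q1. Qed.
Let qm0 : (0 < q - 1)%R. Proof. by rewrite subr_gt0. Qed.

Let c : R := (q / (q - 1))%R.
Let c0 : (0 < c)%R. Proof. by rewrite divr_gt0. Qed.

Let D n x : R := (m n.+1 x `^ (q - 1) - m n x `^ (q - 1))%R.

Let D0 n x : (0 <= D n x)%R.
Proof.
by rewrite subr_ge0 ge0_ler_powR ?nnegrE// ltW.
Qed.

(** Without a jump [D n x] vanishes. At a jump [m n.+1 x <= s n x], so the factor [x] in
    [powR_sub_le] may be replaced by [s n x]. *)
Let step n x :
  (m n.+1 x `^ q)%:E <= (m n x `^ q)%:E + c%:E * ((D n x)%:E * s n x).
Proof.
case: (m_jump n x) => [->|ms_le].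
  by rewrite leeDl// !mule_ge0// lee_fin// ltW.
apply: le_trans (_ : (m n x `^ q)%:E + c%:E * ((D n x)%:E * (m n.+1 x)%:E) <= _).
  rewrite -!EFinM -EFinD lee_fin -lerBlDl (mulrC (D n x)).
  exact: powR_sub_le.
apply: leeD2l; rewrite lee_pmul2l ?lte_fin// lee_wpmul2l ?lee_fin//.
Qed.

Let sub_meas n (g : T -> \bar R) : submeas (F n) g -> measurable_fun setT g.
Proof. by move=> mg; apply: submeas_measurable (sF n) (@FM n) mg. Qed.

Let doob_chi (chi : T -> R) n : (forall x, 0 <= chi x)%R ->
  submeas (F 0%N) (EFin \o chi) ->
  \int[nu]_x ((m n x `^ q)%:E * (chi x)%:E) <=
  c%:E * \int[nu]_x (((chi x)%:E * (m n x `^ (q - 1))%:E) * f x).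
Proof.
move=> chi0 mchi.
have mchiS j : submeas (F j) (EFin \o chi).
  by elim: j => [|j ih] //; exact: subS ih.
have Tchi := sub_meas mchi.
have Tm j r := sub_meas (@mmp j r).
have mfun j : measurable_fun setT
    (fun x => ((chi x)%:E * (m j x `^ (q - 1))%:E) * f x).
  by apply: emeasurable_funM => //; exact: emeasurable_funM.
have nnfun j x : 0 <= ((chi x)%:E * (m j x `^ (q - 1))%:E) * f x.
  by rewrite !mule_ge0// lee_fin ?powR_ge0.
have mD j : submeas (F j) (fun x => (D j x)%:E).
  rewrite /D; under eq_fun do rewrite EFinB.
  by apply: emeasurable_funB; [exact: mmpS|exact: mmp].
elim: n => [|n ih].
  rewrite integral0_eq ?mule_ge0 ?integral_ge0// => [|x _]; first by rewrite lee_fin ltW.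
  by rewrite m_zero powR0 ?mul0e// gt_eqF.
have TD j := sub_meas (mD j); have Ts j := sub_meas (@ms j).
pose A j x := (m j x `^ q)%:E * (chi x)%:E.
pose E x := ((chi x)%:E * (D n x)%:E) * s n x.
pose H x := ((chi x)%:E * (D n x)%:E) * f x.
have A0 j x : 0 <= A j x by rewrite mule_ge0// lee_fin ?powR_ge0.
have mA j : measurable_fun setT (A j) by exact: emeasurable_funM.
have E0 x : 0 <= E x by rewrite !mule_ge0 ?s0// lee_fin.
have mE : measurable_fun setT E.
  by apply: emeasurable_funM (Ts n); exact: emeasurable_funM (TD n).
have H0 x : 0 <= H x by rewrite !mule_ge0 ?f0// lee_fin.
have mH : measurable_fun setT H.
  by apply: emeasurable_funM mf; exact: emeasurable_funM (TD n).
have cE0 x : 0 <= c%:E * E x by rewrite mule_ge0 ?E0// lee_fin ltW.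
have mcE : measurable_fun setT (fun x => c%:E * E x).
  by apply: emeasurable_funM mE; exact: measurable_cst.
have c0' : (0 <= c%:E) by rewrite lee_fin ltW.
apply: (@le_trans _ _ (\int[nu]_x (A n x + c%:E * E x))).
  apply: (ge0_le_integral nu measurableT (fun x _ => A0 n.+1 x) (mA n.+1)).
    exact: emeasurable_funD (mA n) mcE.
  move=> x _; apply: le_trans (lee_wpmul2r _ (step n x)) _.
    by rewrite lee_fin chi0.
  rewrite ge0_muleDl; last 2 first.
  - by rewrite lee_fin powR_ge0.
  - by rewrite mule_ge0// mule_ge0 ?s0// lee_fin D0.
  rewrite leeD2l// /E -!muleA lee_wpmul2l//.
  by rewrite [leRHS]muleC -muleA.
rewrite (ge0_integralD nu measurableT (fun x _ => A0 n x) (mA n) (fun x _ => cE0 x) mcE).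
rewrite (ge0_integralZl nu measurableT mE (fun x _ => E0 x) c0').
have -> : \int[nu]_x E x = \int[nu]_x H x.
  apply: (condexp_pullout (sF n) (@FM n) f0 mf (sP n)).
    by move=> x; rewrite mule_ge0// lee_fin.
  exact: submeasM (mchiS n) (mD n).
apply: le_trans (leeD ih (le_refl _)) _.
rewrite -ge0_muleDr; last 2 first.
- by apply: integral_ge0 => x _; exact: nnfun.
- by apply: integral_ge0 => x _; exact: H0.
rewrite lee_wpmul2l//.
rewrite -(ge0_integralD nu measurableT (fun x _ => nnfun n x) (mfun n) (fun x _ => H0 x) mH).
apply: (ge0_le_integral nu measurableT).
- by move=> x _; rewrite adde_ge0 ?nnfun ?H0.
- exact: emeasurable_funD (mfun n) mH.
- exact: mfun.
move=> x _; rewrite -ge0_muleDl; last 2 first.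
- by rewrite mule_ge0 ?lee_fin ?powR_ge0 ?chi0.
- by rewrite mule_ge0 ?lee_fin ?D0 ?chi0.
rewrite -ge0_muleDr; last 2 first.
- by rewrite lee_fin powR_ge0.
- by rewrite lee_fin D0.
by rewrite -EFinD /D addrC subrK.
Qed.

(** By [powR_absorb] the left side [I] satisfies [I <= I / 2 + B], where [chi <= 1] removes the
    cutoff from the term in [f]. Since [m] is bounded and [chi] integrable, [I] is finite, so half
    of it can be subtracted. *)
Lemma doob_truncated (chi : T -> R) n : (forall x, 0 <= chi x)%R ->
  (forall x, chi x <= 1)%R -> submeas (F 0%N) (EFin \o chi) ->
  \int[nu]_x (chi x)%:E < +oo ->
  \int[nu]_x ((m n x `^ q)%:E * (chi x)%:E) <=
  (doob_const q)%:E * \int[nu]_x (poweR (f x) q).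
Proof.
move=> chi0 chi1 mchi ichi; have Tchi := sub_meas mchi.
have Tm r := sub_meas (@mmp n r).
have Tfq : measurable_fun setT (fun x => poweR (f x) q).
  by apply: (measurableT_comp (measurable_poweR q)).
set I := (X in X <= _); pose B := (c * (2 * c) `^ (q - 1))%:E * \int[nu]_x (poweR (f x) q).
have I0 : 0 <= I by apply: integral_ge0 => x _; rewrite mule_ge0// lee_fin ?powR_ge0.
have B0 : (0 <= c * (2 * c) `^ (q - 1))%R by rewrite mulr_ge0 ?powR_ge0// ltW.
have Bpos : (0 < c * (2 * c) `^ (q - 1))%R by rewrite mulr_gt0 ?powR_gt0// mulr_gt0.
have If : I \is a fin_num.
  rewrite ge0_fin_numE//.
  apply: (@le_lt_trans _ _ ((K `^ q)%:E * \int[nu]_x (chi x)%:E)); last first.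
    by rewrite lte_mul_pinfty// ?lee_fin ?powR_ge0.
  have chi0' x : 0 <= (chi x)%:E by rewrite lee_fin.
  have Kq0 : 0 <= (K `^ q)%:E by rewrite lee_fin powR_ge0.
  rewrite -(ge0_integralZl nu measurableT Tchi (fun x _ => chi0' x) Kq0).
  apply: ge0_le_integral => //.
  - by move=> x _; rewrite mule_ge0// lee_fin ?powR_ge0.
  - exact: emeasurable_funM.
  - exact: emeasurable_funM.
  - move=> x _; rewrite lee_wpmul2r ?lee_fin//.
    by rewrite ge0_ler_powR ?nnegrE ?(ltW q0) ?(le_trans (m0 n x))//.
pose U x := ((chi x)%:E * (m n x `^ (q - 1))%:E) * f x.
pose V x := (m n x `^ q)%:E * (chi x)%:E.
have U0 x : 0 <= U x by rewrite mule_ge0// mule_ge0// lee_fin ?powR_ge0.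
have mU : measurable_fun setT U.
  by apply: emeasurable_funM mf; exact: emeasurable_funM Tchi (Tm _).
have V0 x : 0 <= V x by rewrite mule_ge0// lee_fin ?powR_ge0.
have mV : measurable_fun setT V by exact: emeasurable_funM (Tm _) Tchi.
have half0 : 0 <= 2^-1%:E :> \bar R by rewrite lee_fin invr_ge0.
have c0' : 0 <= c%:E by rewrite lee_fin ltW.
have fq0 x : 0 <= poweR (f x) q by exact: poweR_ge0.
have B0' : 0 <= (c * (2 * c) `^ (q - 1))%:E by rewrite lee_fin.
have mcst (r : R) (g : T -> \bar R) : measurable_fun setT g ->
    measurable_fun setT (fun x => r%:E * g x).
  by move=> mg; apply: emeasurable_funM mg; exact: measurable_cst.
have IB : I <= 2^-1%:E * I + B.
  apply: le_trans (doob_chi n chi0 mchi) _; rewrite -/c.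
  rewrite /I /B -(ge0_integralZl nu measurableT mU (fun x _ => U0 x) c0').
  rewrite -(ge0_integralZl nu measurableT mV (fun x _ => V0 x) half0).
  rewrite -(ge0_integralZl nu measurableT Tfq (fun x _ => fq0 x) B0').
  rewrite -ge0_integralD; [|exact: measurableT| | | |]; last first.
  - exact: mcst.
  - by move=> x _; rewrite mule_ge0.
  - exact: mcst.
  - by move=> x _; rewrite mule_ge0.
  apply: (ge0_le_integral nu measurableT).
  - by move=> x _; rewrite mule_ge0.
  - exact: mcst.
  - by apply: emeasurable_funD; exact: mcst.
  move=> x _; rewrite /U /V; case E : (f x) (f0 x) => [r| |] // fx0; last first.
    rewrite poweRyr ?gt_eqF// [X in _ <= _ + X]gt0_muley ?lte_fin//.
    by rewrite addey ?leey// -!EFinM.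
  rewrite /= -!EFinM -EFinD lee_fin; rewrite lee_fin in fx0.
  have := powR_absorb q1 c0 (m0 n x) fx0.
  move: (chi0 x) (chi1 x) (mulr_ge0 B0 (powR_ge0 r q)).
  move: (m n x `^ q)%R (m n x `^ (q - 1))%R (chi x) => a b e e0 e1.
  set z := (_ * r `^ q)%R => z0 h.
  have h1 : (e * (c * (b * r)) <= e * (2^-1 * a + z))%R by rewrite ler_wpM2l.
  have h2 : (e * z <= z)%R by rewrite ler_piMl.
  have -> : (c * (e * b * r) = e * (c * (b * r)))%R by ring.
  apply: (le_trans h1); rewrite mulrDr.
  have -> : (2^-1 * (a * e) = e * (2^-1 * a))%R by ring.
  exact: lerD.
have -> : (doob_const q)%:E * \int[nu]_x (poweR (f x) q) = 2%:E * B.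
  by rewrite /B muleA -EFinM.
have B_ge0 : 0 <= B.
  by rewrite mule_ge0// integral_ge0// => x _; exact: poweR_ge0.
clearbody B; case: B B_ge0 IB => [b| |] // b0 IB; last first.
  by rewrite gt0_muley ?lte_fin ?leey.
move: IB; rewrite -(fineK If) -!EFinM -EFinD !lee_fin; lra.
Qed.

End doob_truncated.

(** * Removing the truncation *)

Section doob.
Local Open Scope ereal_scope.
Context d (T : measurableType d) (R : realType).
Variables (nu : {measure set T -> \bar R}) (F : nat -> set (set T)).
Hypotheses (sF : forall n, sigma_algebra setT (F n))
  (FM : forall n, F n `<=` measurable) (FS : forall n, F n `<=` F n.+1).
Hypothesis sfF : sigma_fin nu (F 0%N).
Variables (q : R) (f : T -> \bar R) (s : nat -> T -> \bar R).
Hypotheses (q1 : (1 < q)%R) (f0 : forall x, 0 <= f x)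
  (mf : measurable_fun setT f) (sP : forall n, is_condexp nu (F n) f (s n)).

Let s0 n x : 0 <= s n x. Proof. by have [] := sP n. Qed.
Let ms n : submeas (F n) (s n).
Proof. by have [_ /(submeasP _ (sF n))] := sP n. Qed.

Let subS n (g : T -> \bar R) : submeas (F n) g -> submeas (F n.+1) g.
Proof. exact: submeasS (sF n) (sF n.+1) (@FS n). Qed.

Let t k n x : R := fine (mine (s n x) k%:R%:E).
Let m k := fix m n x : R :=
  if n is n'.+1 then Num.max (m n' x) (t k n' x) else 0%R.

Let tE k n x : (t k n x)%:E = mine (s n x) k%:R%:E.
Proof.
rewrite fineK// ge0_fin_numE; first by rewrite gt_min ltry orbT.
by rewrite le_min s0 lee_fin ler0n.
Qed.

Let tk k n x : (t k n x <= k%:R)%R.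
Proof. by rewrite -lee_fin tE ge_min lexx orbT. Qed.

Let m0 k n x : (0 <= m k n x)%R.
Proof. by elim: n => [|n ih]//=; rewrite le_max ih. Qed.

Let mk k n x : (m k n x <= k%:R)%R.
Proof. by elim: n => [|n ih]//=; rewrite ge_max ih tk. Qed.

Let mm k n : submeas (F n) (fun x => (m k n.+1 x)%:E).
Proof.
have mt j : submeas (F j) (fun x => (t k j x)%:E).
  under eq_fun do rewrite tE.
  by apply: measurable_mine; [exact: ms|exact: measurable_cst].
have E j : (fun x => (m k j.+1 x)%:E) = (fun x => maxe (m k j x)%:E (t k j x)%:E).
  by apply/funext => x; rewrite /= EFin_max.
elim: n => [|n ih]; rewrite E; apply: measurable_maxe; try exact: mt.
  exact: (@submeas_cst _ T R (F 0%N) 0%E).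
exact: subS ih.
Qed.

Let nd_m k n x : (m k n x <= m k n.+1 x)%R.
Proof. by rewrite /= le_max lexx. Qed.

Let m_jump k n x : m k n.+1 x = m k n x \/ (m k n.+1 x)%:E <= s n x.
Proof.
have [tm|mt] := leP (t k n x) (m k n x); [left|right].
  by apply/max_idPl.
have -> : m k n.+1 x = t k n x by apply/max_idPr; exact: ltW.
by rewrite tE ge_min lexx.
Qed.

Let sub_meas n (g : T -> \bar R) : submeas (F n) g -> measurable_fun setT g.
Proof. by move=> mg; apply: submeas_measurable (sF n) (@FM n) mg. Qed.

(** Truncation level, time and cutoff are tied to one index [k]. The products [h k] increase, their
    supremum dominates every [s n], and a single monotone convergence removes all three
    restrictions. *)
Theorem doob_maximal :
  \int[nu]_x poweR (ereal_sup (range (s ^~ x))) q <=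
  (doob_const q)%:E * \int[nu]_x (poweR (f x) q).
Proof.
have q0 : (0 < q)%R by exact: lt_trans ltr01 q1.
have [psi [psi0 mpsi ipsi]] := sfF.
have Tpsi := sub_meas mpsi.
(* Integrable [F 0]-measurable cutoffs that increase to 1, because [psi > 0]. *)
pose chi k x := Num.min 1%R (k%:R * psi x)%R.
have chi0 k x : (0 <= chi k x)%R by rewrite le_min ler01 mulr_ge0// ltW.
have chi1 k x : (chi k x <= 1)%R by rewrite ge_min lexx.
have mchi k : submeas (F 0%N) (EFin \o chi k).
  rewrite (_ : _ \o _ = (fun x => mine 1 (k%:R%:E * (psi x)%:E))).
    apply: measurable_mine; first exact: measurable_cst.
    by apply: submeasM => //; exact: (@submeas_cst _ T R (F 0%N) k%:R%:E).
  by apply/funext => x; rewrite /= EFin_min EFinM.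
have ichi k : \int[nu]_x (chi k x)%:E < +oo.
  apply: (@le_lt_trans _ _ (k%:R%:E * \int[nu]_x (psi x)%:E)); last first.
    by rewrite lte_mul_pinfty// ?lee_fin.
  rewrite -ge0_integralZl//; last by move=> x _; rewrite lee_fin ltW.
  apply: ge0_le_integral => //.
  - by move=> x _; rewrite lee_fin.
  - exact: sub_meas (mchi k).
  - exact: emeasurable_funM.
  - by move=> x _; rewrite -EFinM lee_fin ge_min lexx orbT.
have mmk k n : measurable_fun setT (fun x => (m k n x)%:E).
  case: n => [|n]; last exact: sub_meas (@mm k n).
  exact: (sub_meas (@submeas_cst _ T R (F 0%N) 0)).
pose h k x := (m k k x * chi k x)%:E.
have h0 k x : 0 <= h k x by rewrite lee_fin mulr_ge0.
have mhq k : measurable_fun setT (fun x => poweR (h k x) q).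
  apply: (measurableT_comp (measurable_poweR q)); rewrite /h.
  under eq_fun do rewrite EFinM.
  apply: emeasurable_funM; last exact: sub_meas (mchi k).
  exact: mmk.
have nd_t k n x : (t k n x <= t k.+1 n x)%R.
  by rewrite -lee_fin !tE le_min ge_min lexx/= ge_min lee_fin ler_nat leqnSn orbT.
have nd_mk k n x : (m k n x <= m k.+1 n x)%R.
  elim: n => [|n ih]//=; rewrite ge_max !le_max ih/=.
  by rewrite nd_t orbT.
have nd_mn k i j x : (i <= j)%N -> (m k i x <= m k j x)%R.
  move=> /subnK <-; elim: (j - i)%N => // l ih.
  by rewrite addSn (le_trans ih).
have nd_chi k x : (chi k x <= chi k.+1 x)%R.
  rewrite le_min ge_min lexx/= ge_min ler_wpM2r ?orbT// ?ler_nat// ltW//.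
have nd_h k x : h k x <= h k.+1 x.
  by rewrite lee_fin ler_pM// (le_trans (nd_mk _ _ _)).
have sh n x : s n x <= ereal_sup (range (h ^~ x)).
  have key j : mine (s n x) j%:R%:E <= ereal_sup (range (h ^~ x)).
    (* The three terms ensure that the maximum [m k k] includes time [n], that the truncation level
       is at least [j], and that [chi k x = 1]. *)
    pose k := (maxn n.+1 (maxn j (Num.truncn (psi x)^-1).+1)).
    apply: le_trans (_ : h k x <= _); last by apply: ereal_sup_ubound; exists k.
    have chik : chi k x = 1%R.
      apply/min_idPl; rewrite -ler_pdivrMr// mul1r.
      apply: (le_trans (ltW (truncnS_gt _))); rewrite ler_nat /k.
      by rewrite !leq_max leqnn !orbT.
    rewrite /h chik mulr1.
    apply: le_trans (_ : (t k n x)%:E <= _).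
      rewrite tE le_min ge_min lexx/= ge_min lee_fin ler_nat.
      by rewrite /k !leq_max leqnn !orbT.
    rewrite lee_fin; apply: le_trans (_ : m k n.+1 x <= _)%R.
      by rewrite /= le_max lexx orbT.
    by apply: nd_mn; rewrite /k leq_max leqnn.
  case E : (s n x) (s0 n x) => [r| |] // _.
    have := key (Num.truncn r).+1; rewrite E min_l// lee_fin.
    exact/ltW/truncnS_gt.
  rewrite leye_eq; apply/eqP/eqyP => A A0.
  have := key (Num.truncn A).+1; rewrite E min_r ?leey//.
  by apply: le_trans; rewrite lee_fin; exact/ltW/truncnS_gt.
apply: le_trans (_ : \int[nu]_x poweR (ereal_sup (range (h ^~ x))) q <= _).
  apply: ge0_le_integral => //.
  - by move=> x _; exact: poweR_ge0.
  - apply: (measurableT_comp (measurable_poweR q)).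
    by apply: measurable_fun_ereal_sup => n; exact: sub_meas (@ms n).
  - apply: (measurableT_comp (measurable_poweR q)).
    apply: measurable_fun_ereal_sup => k; rewrite /h.
    under eq_fun do rewrite EFinM.
    apply: emeasurable_funM; last exact: sub_meas (mchi k).
    exact: mmk.
  - move=> x _; apply: le_poweR2r; first exact: ltW.
      by apply: (le_trans (s0 0%N x)); apply: ereal_sup_ubound; exists 0%N.
    by apply: ge_ereal_sup => _ [n _ <-].
under eq_integral do rewrite poweR_ereal_sup//.
rewrite ae_ge0_integral_ereal_sup//; last 2 first.
- by move=> k x; exact: poweR_ge0.
- by move=> k; apply: aeW => x; apply: le_poweR2r => //; exact: ltW.
apply: ge_ereal_sup => _ [k _ <-].
have := doob_truncated sF FM FS q1 f0 mf sP (fun=> erefl) (m0 k) (mk k) (nd_m k)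
  (@mm k) (m_jump k) k (chi0 k) (chi1 k) (mchi k) (ichi k).
apply: le_trans.
apply: ge0_le_integral => //.
- by move=> x _; exact: poweR_ge0.
- apply: emeasurable_funM; last exact: sub_meas (mchi k).
  exact: (measurableT_comp (measurable_poweR q) (mmk k k)).
(* [chi^q <= chi], since chi lies in [0, 1] and q > 1. *)
move=> x _; rewrite /h /= powRM// EFinM lee_wpmul2l ?lee_fin ?powR_ge0//.
have [->|chin0] := eqVneq (chi k x) 0%R; first by rewrite powR0 ?gt_eqF.
rewrite -[leRHS]powRr1// ger_powR ?chi1 ?andbT ?(ltW q1)//.
by rewrite lt0r chin0 chi0.
Qed.

End doob.

(** * Weighted measures *)

Lemma submeas_quotient {T : pointedType} {R : realType} (G : set (set T))
    (psi : T -> R) (g : T -> \bar R) :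
  submeas G (EFin \o psi) -> submeas G g ->
  submeas G (fun x => (psi x * (1 + fine (g x)) `^ (-1))%:E).
Proof.
move=> mpsi mg; apply: (@emeasurable_funM _ (g_sigma_algebraType G) R setT (EFin \o psi)
    (fun x => ((1 + fine (g x)) `^ (-1))%:E)) => //.
apply/measurable_EFinP; apply: (measurableT_comp (measurable_powR (-1))).
apply: measurable_funD; first exact: measurable_cst.
exact: (measurableT_comp (fine_measurable measurableT)).
Qed.

Section density_facts.
Local Open Scope ereal_scope.
Context d (T : measurableType d) (R : realType).
Variables (mu : {measure set T -> \bar R}) (rho : T -> R).
Hypotheses (rho0 : forall x, (0 < rho x)%R) (mrho : measurable_fun setT rho).

Let rho_ge0 x : 0 <= (rho x)%:E. Proof. by rewrite lee_fin ltW. Qed.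
Let mErho : measurable_fun setT (EFin \o rho). Proof. exact/measurable_EFinP. Qed.

Definition weighted := density mu rho_ge0 mErho.
HB.instance Definition _ := Measure.on weighted.

Lemma integral_weighted (g : T -> \bar R) :
  (forall x, 0 <= g x) -> measurable_fun setT g ->
  \int[weighted]_x g x = \int[mu]_x (g x * (rho x)%:E).
Proof. exact: ge0_integral_density. Qed.

Lemma integral_weighted_in (A : set T) (g : T -> \bar R) : measurable A ->
  (forall x, 0 <= g x) -> measurable_fun setT g ->
  \int[weighted]_(x in A) g x = \int[mu]_(x in A) (g x * (rho x)%:E).
Proof.
move=> mA g0 mg; rewrite [LHS]integral_mkcond [RHS]integral_mkcond.
transitivity (\int[mu]_x ((g \_ A) x * (rho x)%:E)); first apply: integral_weighted.
- by move=> x; exact: erestrict_ge0.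
- by apply: (measurable_restrictT g mA).1; exact: measurable_funTS.
apply: eq_integral => x _.
by rewrite /patch; case: ifP => //; rewrite mul0e.
Qed.

(** A strictly positive density creates no new null sets. With the converse [weighted_ae], a.e.
    statements pass freely between [mu], [w mu] and [sigma mu]. *)
Lemma ae_weighted (P : T -> Prop) :
  {ae weighted, forall x, P x} -> {ae mu, forall x, P x}.
Proof.
move=> [N [mN N0 PN]].
have /(_ mN) negN := @integral_le0_negligible _ _ _ mu N (EFin \o rho).
apply: negligibleS PN _; apply: negN.
- exact: measurable_funTS.
- by move=> x _; rewrite lte_fin.
- by rewrite le_eqVlt; apply/orP; left; apply/eqP.
Qed.

Variable G : set (set T).
Hypotheses (sG : sigma_algebra setT G) (GM : G `<=` measurable).

(* Dividing an integrable weight by [1 + E(rho | G)] makes it integrable against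
   [rho mu]. *)
Lemma sigma_fin_weighted (g : T -> \bar R) : sigma_fin mu G ->
  is_condexp mu G (EFin \o rho) g -> {ae mu, forall x, g x < +oo} ->
  sigma_fin weighted G.
Proof.
move=> [psi [psi0 mpsi ipsi]] gP gfin.
have [g0 /(submeasP _ sG) mg _] := gP.
have g1 x : (0 < 1 + fine (g x))%R by rewrite ltr_wpDr// fine_ge0.
pose psi' x := (psi x * (1 + fine (g x)) `^ (-1))%R.
have psi'0 x : (0 < psi' x)%R by rewrite mulr_gt0// powR_gt0.
have mpsi' : submeas G (EFin \o psi').
  exact: submeas_quotient mpsi mg.
have Tmpsi' := submeas_measurable sG GM mpsi'.
exists psi'; split => //.
rewrite integral_weighted//; last by move=> x; rewrite lee_fin ltW.
rewrite -(condexp_pullout sG GM rho_ge0 mErho gP)//; last first.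
  by move=> x; rewrite lee_fin ltW.
apply: le_lt_trans ipsi; apply: ae_ge0_le_integral => //.
- by move=> x _; rewrite mule_ge0// lee_fin ltW.
- by apply: emeasurable_funM => //; exact: submeas_measurable mg.
- by move=> x _; rewrite lee_fin ltW.
- exact: submeas_measurable mpsi.
apply: filterS gfin => x gx _.
have gf : g x \is a fin_num by rewrite ge0_fin_numE.
rewrite -(fineK gf) -EFinM lee_fin /psi' powR_inv1 ?(ltW (g1 x))//.
rewrite -mulrA ler_piMr ?(ltW (psi0 x))// mulrC ler_pdivrMr// mul1r.
by rewrite lerDr.
Qed.

End density_facts.

(** * Order and increasing limits under conditional expectation *)

Section condexp_sup.
Local Open Scope ereal_scope.
Context d (T : measurableType d) (R : realType).
Variables (nu : {measure set T -> \bar R}) (G : set (set T)).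
Hypotheses (sG : sigma_algebra setT G) (GM : G `<=` measurable).
Hypothesis sfG : sigma_fin nu G.

(** Applied with [f' = f], this also yields a.e. uniqueness of the conditional expectation. *)
Lemma condexp_le_ae (f f' g g' : T -> \bar R) :
  (forall x, 0 <= f x) -> measurable_fun setT f ->
  (forall x, 0 <= f' x) -> measurable_fun setT f' ->
  is_condexp nu G f g -> is_condexp nu G f' g' ->
  {ae nu, forall x, f x <= f' x} -> {ae nu, forall x, g x <= g' x}.
Proof.
move=> f0 mf f'0 mf' [g0 /(submeasP _ sG) mg fg] [g'0 /(submeasP _ sG) mg' fg'] ff'.
apply: (submeas_le_ae sG GM sfG) => // A GA; rewrite fg// fg'//.
have mA : measurable A by exact: GM.
apply: ae_ge0_le_integral => //; [exact: measurable_funTS..|].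
by apply: filterS ff' => x.
Qed.

(** One half of conditional monotone convergence, the half that carries the inequalities of the
    iteration to its limit. Integrals over sets of [G] are compared, with monotone convergence on
    both sides. *)
Lemma condexp_ereal_sup_le (f e : nat -> T -> \bar R) (g : T -> \bar R) :
  (forall k x, 0 <= f k x) -> (forall k, measurable_fun setT (f k)) ->
  (forall k, {ae nu, forall x, f k x <= f k.+1 x}) ->
  (forall k, is_condexp nu G (f k) (e k)) ->
  is_condexp nu G (fun x => ereal_sup (range (f ^~ x))) g ->
  {ae nu, forall x, g x <= ereal_sup (range (e ^~ x))}.
Proof.
move=> f0 mf ndf eP [g0 /(submeasP _ sG) mg fg].
have e0 k x : 0 <= e k x by have [] := eP k.
have me k : submeas G (e k) by have [_ /(submeasP _ sG)] := eP k.
have nde k : {ae nu, forall x, e k x <= e k.+1 x}.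
  exact: (condexp_le_ae (f0 k) (mf k) (f0 k.+1) (mf k.+1) (eP k) (eP k.+1) (ndf k)).
apply: (submeas_le_ae sG GM sfG) => //.
- by move=> x; apply: (le_trans (e0 0%N x)); apply: ereal_sup_ubound; exists 0%N.
- exact: (@measurable_fun_ereal_sup _ (g_sigma_algebraType G)).
move=> A GA; have mA : measurable A by exact: GM.
rewrite fg// !ae_ge0_integral_ereal_sup//; last first.
  by move=> k; exact: submeas_measurable (me k).
apply: ge_ereal_sup => _ [k _ <-]; apply: ereal_sup_ubound; exists k => //.
by have [_ _] := eP k; exact.
Qed.

End condexp_sup.

(** * The iteration *)

Section rubio_de_francia.
Local Open Scope ereal_scope.
Context d (T : measurableType d) (R : realType).
Variables (mu : {measure set T -> \bar R}) (w : T -> R) (p : R).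
Hypotheses (w0 : forall x, (0 < w x)%R) (mw : measurable_fun setT w) (p0 : (0 < p)%R).

Local Notation nn v := (forall x : T, 0 <= v x).
Local Notation meas v := (measurable_fun [set: T] v).

Let w_ge0 x : 0 <= (w x)%:E. Proof. by rewrite lee_fin ltW. Qed.
Let mEw : meas (EFin \o w). Proof. exact/measurable_EFinP. Qed.

(** The p-th power of the norm of L^p(w mu). Without the root, the bound for a maximum of two
    functions is pointwise and Minkowski's inequality is avoided. *)
Definition wnorm (v : T -> \bar R) := \int[mu]_x (poweR (v x) p * (w x)%:E).

Let mpow v : meas v -> meas (fun x => poweR (v x) p * (w x)%:E).
Proof.
by move=> mv; apply: emeasurable_funM mEw; exact: (measurableT_comp (measurable_poweR p)).
Qed.

Let pow0 v x : 0 <= poweR (v x) p * (w x)%:E.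
Proof. by rewrite mule_ge0// poweR_ge0. Qed.

Lemma wnorm_max (u v : T -> \bar R) : meas u -> meas v ->
  wnorm (fun x => maxe (u x) (v x)) <= wnorm u + wnorm v.
Proof.
move=> mu' mv; rewrite /wnorm.
rewrite -(ge0_integralD mu measurableT (fun x _ => pow0 u x) (mpow mu')
  (fun x _ => pow0 v x) (mpow mv)).
apply: (ge0_le_integral mu measurableT).
- by move=> x _; exact: (pow0 (fun x => maxe (u x) (v x))).
- by apply: mpow; exact: measurable_maxe.
- by apply: emeasurable_funD; exact: mpow.
- move=> x _; rewrite -ge0_muleDl ?poweR_ge0//; apply: lee_wpmul2r => //.
  by case: (leP (u x) (v x)) => _; rewrite ?leeDl ?leeDr ?poweR_ge0.
Qed.

Lemma wnormZ (c : R) (v : T -> \bar R) : (0 <= c)%R -> nn v -> meas v ->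
  wnorm (fun x => c%:E * v x) = (c `^ p)%:E * wnorm v.
Proof.
move=> c0 v0 mv; rewrite /wnorm.
have cp0 : 0 <= (c `^ p)%:E by rewrite lee_fin powR_ge0.
rewrite -(ge0_integralZl mu measurableT (mpow mv) (fun x _ => pow0 v x) cp0).
by apply: eq_integral => x _; rewrite poweRM ?lee_fin// muleA.
Qed.

Variables (S : (T -> \bar R) -> T -> \bar R) (C eps : R) (v0 : T -> \bar R).
Hypotheses (S0 : forall v, nn v -> meas v -> nn (S v))
  (mS : forall v, nn v -> meas v -> meas (S v))
  (ndS : forall u v, nn u -> meas u -> nn v -> meas v ->
    {ae mu, forall x, u x <= v x} -> {ae mu, forall x, S u x <= S v x})
  (bS : forall v, nn v -> meas v -> wnorm (S v) <= C%:E * wnorm v)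
  (eps0 : (0 < eps)%R) (epsC : (eps `^ p * C = 2^-1)%R)
  (v00 : nn v0) (mv0 : meas v0) (iv0 : wnorm v0 < +oo).

(* The increasing iteration [v := max(v0, eps S v)] replaces the usual series
   [sum eps^k S^k v0]: it requires monotonicity of [S] but no subadditivity. *)
Lemma rubio_de_francia : exists v : nat -> T -> \bar R,
  [/\ forall k, nn (v k) /\ meas (v k),
      forall k, {ae mu, forall x, v k x <= v k.+1 x},
      forall k x, v0 x <= v k x,
      forall k x, eps%:E * S (v k) x <= v k.+1 x
    & wnorm (fun x => ereal_sup (range (v ^~ x))) < +oo].
Proof.
pose v := fix v k x := if k is k'.+1 then maxe (v0 x) (eps%:E * S (v k') x) else v0 x.
have eps0' : 0 <= eps%:E by rewrite lee_fin ltW.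
have v0v k x : v0 x <= v k x by case: k => //= k; rewrite le_max lexx.
have vnn k : nn (v k) by move=> x; exact: le_trans (v00 x) (v0v k x).
have mv k : meas (v k).
  elim: k => // k ih; apply: measurable_maxe => //.
  by apply: emeasurable_funM; [exact: measurable_cst|exact: mS].
have ndv k : {ae mu, forall x, v k x <= v k.+1 x}.
  elim: k => [|k ih]; first by apply: aeW => x; exact: v0v.
  have := ndS (vnn k) (mv k) (vnn k.+1) (mv k.+1) ih.
  apply: filterS => x Sx; rewrite [leLHS]/= [leRHS]/=.
  by rewrite ge_max !le_max lexx/= lee_wpmul2l ?orbT.
have iv k : wnorm (v k) <= 2%:E * wnorm v0.
  have I0 : 0 <= wnorm v0 by apply: integral_ge0 => x _; exact: (pow0 v0).
  have If : wnorm v0 \is a fin_num by rewrite ge0_fin_numE.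
  elim: k => [|k ih].
    by rewrite -[leLHS]mul1e lee_wpmul2r// lee_fin ler1n.
  have mSv := mS (vnn k) (mv k).
  apply: (@le_trans _ _ (wnorm v0 + wnorm (fun x => eps%:E * S (v k) x))).
    apply: wnorm_max => //.
    by apply: emeasurable_funM mSv; exact: measurable_cst.
  rewrite (wnormZ (ltW eps0) (S0 (vnn k) (mv k)) mSv).
  have h1 : (eps `^ p)%:E * wnorm (S (v k)) <= (eps `^ p)%:E * (C%:E * wnorm (v k)).
    by rewrite lee_wpmul2l ?lee_fin ?powR_ge0//; exact: bS.
  apply: le_trans (leeD (le_refl _) h1) _.
  rewrite muleA -EFinM epsC.
  have h2 : 2^-1%:E * wnorm (v k) <= 2^-1%:E * (2%:E * wnorm v0).
    by rewrite lee_wpmul2l ?lee_fin ?invr_ge0.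
  apply: le_trans (leeD (le_refl _) h2) _.
  rewrite -(fineK If) -!EFinM -EFinD lee_fin; lra.
exists v; split => //.
- by move=> k x /=; rewrite le_max lexx orbT.
apply: (@le_lt_trans _ _ (2%:E * wnorm v0)); last by rewrite lte_mul_pinfty.
rewrite /wnorm (eq_integral (fun x => ereal_sup (range (fun k => poweR (v k x) p * (w x)%:E)))); last first.
  move=> x _; rewrite poweR_ereal_sup; [|exact: p0|by move=> k; exact: vnn].
  rewrite muleC ge0_mule_ereal_sup//; congr ereal_sup.
  by apply: eq_imagel => k _; rewrite muleC.
rewrite (@ae_ge0_integral_ereal_sup _ _ _ mu setT
  (fun k x => poweR (v k x) p * (w x)%:E) measurableT); last 3 first.
- by move=> k x; exact: (pow0 (v k)).
- by move=> k; exact: mpow.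
- move=> k; apply: filterS (ndv k) => x vx; apply: lee_wpmul2r => //.
  by apply: le_poweR2r; [exact: ltW|exact: vnn|].
by apply: ge_ereal_sup => _ [k _ <-]; exact: iv.
Qed.

End rubio_de_francia.

(** * The maximal operator of a filtration *)

Section maximal_operator.
Local Open Scope ereal_scope.
Context d (T : measurableType d) (R : realType).
Variables (nu : {measure set T -> \bar R}) (F : nat -> set (set T)).
Hypotheses (sF : forall n, sigma_algebra setT (F n))
  (FM : forall n, F n `<=` measurable) (FS : forall n, F n `<=` F n.+1).
Hypothesis sfF : sigma_fin nu (F 0%N).

Local Notation nn v := (forall x : T, 0 <= v x).
Local Notation meas v := (measurable_fun [set: T] v).

Lemma sigma_fin_filtration n : sigma_fin nu (F n).
Proof.
elim: n => // n [psi [psi0 mpsi ipsi]]; exists psi; split => //.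
exact: submeasS (sF n) (sF n.+1) (@FS n) mpsi.
Qed.

(** One version is fixed for every index and function, so that the maximal function becomes an
    operator that can be iterated. Arguments outside the domain get the dummy value 0. *)
Lemma condexp_operator : exists E : nat -> (T -> \bar R) -> T -> \bar R,
  forall n f, nn f -> meas f -> is_condexp nu (F n) f (E n f).
Proof.
have /choice[E EP] : forall nf : nat * (T -> \bar R), exists g,
    nn nf.2 -> meas nf.2 -> is_condexp nu (F nf.1) nf.2 g.
  move=> [n f] /=; have [f0|/existsNP nf] := pselect (nn f).
    have [mf|nmf] := pselect (meas f); last by exists (cst 0).
    have [g gP] := condexp_exists (sF n) (@FM n) (sigma_fin_filtration n) f0 mf.
    by exists g.
  by exists (cst 0) => f0; case: nf => x; rewrite f0.
by exists (fun n f => E (n, f)) => n f f0 mf; exact: (EP (n, f)).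
Qed.

Variable E : nat -> (T -> \bar R) -> T -> \bar R.
Hypothesis EP : forall n f, nn f -> meas f -> is_condexp nu (F n) f (E n f).

Definition maximal (f : T -> \bar R) x := ereal_sup (range (fun n => E n f x)).

Lemma le_maximal n f x : E n f x <= maximal f x.
Proof. by apply: ereal_sup_ubound; exists n. Qed.

Lemma maximal_ge0 f : nn f -> meas f -> nn (maximal f).
Proof.
move=> f0 mf x; have [E0 _ _] := EP 0%N f0 mf.
by apply: (le_trans (E0 x)); exact: le_maximal.
Qed.

Lemma measurable_maximal f : nn f -> meas f -> meas (maximal f).
Proof.
move=> f0 mf; apply: measurable_fun_ereal_sup => n.
have [_ /(submeasP _ (sF n)) mE _] := EP n f0 mf.
exact: submeas_measurable (sF n) (@FM n) mE.
Qed.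

Lemma maximal_le_ae f g : nn f -> meas f -> nn g -> meas g ->
  {ae nu, forall x, f x <= g x} -> {ae nu, forall x, maximal f x <= maximal g x}.
Proof.
move=> f0 mf g0 mg fg.
have /ae_foralln : forall n, {ae nu, forall x, E n f x <= E n g x}.
  move=> n; exact: (condexp_le_ae (sF n) (@FM n) (sigma_fin_filtration n)
    f0 mf g0 mg (EP n f0 mf) (EP n g0 mg) fg).
apply: filterS => x Ex; apply: ge_ereal_sup => _ [n _ <-].
exact: le_trans (Ex n) (le_maximal n g x).
Qed.

Lemma maximal_bound (q : R) f : (1 < q)%R -> nn f -> meas f ->
  \int[nu]_x poweR (maximal f x) q <= (doob_const q)%:E * \int[nu]_x poweR (f x) q.
Proof.
move=> q1 f0 mf; exact: (doob_maximal sF FM FS sfF q1 f0 mf (fun n => EP n f0 mf)).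
Qed.

End maximal_operator.

Lemma weighted_ae d (T : measurableType d) (R : realType)
    (mu : {measure set T -> \bar R}) (rho : T -> R)
    (rho0 : forall x, 0 < rho x) (mrho : measurable_fun setT rho) (P : T -> Prop) :
  {ae mu, forall x, P x} -> {ae weighted mu rho0 mrho, forall x, P x}.
Proof.
move=> [N [mN N0 PN]]; exists N; split => //.
have mE : measurable_fun N (EFin \o rho) by apply: measurable_funTS; exact/measurable_EFinP.
rewrite -(integral_abs_eq0 mN mE N0).
apply: eq_integral => x _; rewrite gee0_abs//= lee_fin; exact: ltW.
Qed.

(** * The dual weight and the iteration constant *)

Definition dual_weight {T : Type} {R : realType} (p : R) (w : T -> R) (x : T) : R :=
  w x `^ (1 / (1 - p)).

Section dual_weight.
Context (T : Type) (R : realType) (p : R) (w : T -> R).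
Hypotheses (p1 : 1 < p) (w0 : forall x, 0 < w x).
Local Notation sg := (dual_weight p w).

Lemma dual_weight_gt0 x : 0 < sg x.
Proof. exact: powR_gt0. Qed.

Let np : 1 - p != 0. Proof. by rewrite lt_eqF// subr_lt0. Qed.

Let wD x a b : w x `^ (a + b) = w x `^ a * w x `^ b.
Proof. by rewrite powRD// (gt_eqF (w0 x)) implybT. Qed.

(** Exponents: p / (1 - p) + 1 = 1 / (1 - p). Together with the next identity it makes
    [v |-> v / sigma] an isometry from L^p(w mu) to L^p(sigma mu). *)
Lemma dual_weight_powp x : sg x `^ p * w x = sg x.
Proof.
transitivity (w x `^ (1 / (1 - p) * p + 1)).
  by rewrite wD powRr1 ?(ltW (w0 x))// powRrM.
by congr (_ `^ _); field.
Qed.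

Lemma dual_weight_invp x : (sg x)^-1 `^ p * sg x = w x.
Proof.
rewrite -powR_inv1 ?(ltW (dual_weight_gt0 x))// /dual_weight -!powRrM -wD.
by rewrite -[RHS](powRr1 (ltW (w0 x))); congr (_ `^ _); field.
Qed.

Lemma dual_weight_inv x : (sg x)^-1 `^ (p - 1) = w x.
Proof.
rewrite -powR_inv1 ?(ltW (dual_weight_gt0 x))// /dual_weight -!powRrM.
by rewrite -[RHS](powRr1 (ltW (w0 x))); congr (_ `^ _); field.
Qed.

End dual_weight.

Lemma measurable_dual_weight d (T : measurableType d) (R : realType) (p : R)
  (w : T -> R) : measurable_fun setT w -> measurable_fun setT (dual_weight p w).
Proof. exact: (measurableT_comp (measurable_powR _)). Qed.

Lemma measurable_dual_weight_inv d (T : measurableType d) (R : realType) (p : R)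
  (w : T -> R) : (forall x, 0 < w x) -> measurable_fun setT w ->
  measurable_fun setT (fun x => ((dual_weight p w x)^-1)%:E).
Proof.
move=> w0 mw; apply/measurable_EFinP.
rewrite (_ : (fun x => _) = (fun x => dual_weight p w x `^ (-1))).
  by apply: (measurableT_comp (measurable_powR (-1))); exact: measurable_dual_weight.
by apply/funext => x; rewrite powR_inv1// ltW// dual_weight_gt0.
Qed.

(** The two Doob constants, for p and its conjugate exponent, are added because the iterated
    operator is the maximum of two. The factor 2 makes each step of the iteration gain one half. *)
Definition rdf_eps {R : realType} (p : R) : R :=
  (2 * (doob_const p + doob_const (p / (p - 1)))) `^ (- p^-1).

Section rdf_eps.
Context (R : realType) (p : R).
Hypothesis p1 : 1 < p.

Let C : R := doob_const p + doob_const (p / (p - 1)).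

Lemma conjugate_gt1 : 1 < p / (p - 1).
Proof. by rewrite ltr_pdivlMr ?subr_gt0// mul1r gtrBl. Qed.

Let C0 : 0 < C.
Proof. by rewrite addr_gt0// doob_const_gt0//; exact: conjugate_gt1. Qed.

Lemma rdf_eps_gt0 : 0 < rdf_eps p.
Proof. by rewrite powR_gt0// mulr_gt0. Qed.

Lemma rdf_epsC : rdf_eps p `^ p * C = 2^-1.
Proof.
have p0 : p != 0 by rewrite gt_eqF// (lt_trans ltr01).
rewrite /rdf_eps -/C -powRrM mulNr mulVf// powR_inv1; last by rewrite mulr_ge0// ltW.
by field; rewrite gt_eqF.
Qed.

End rdf_eps.

(** * Iterating both maximal operators at once on L^p(w mu) *)

Section weighted_A1.
Local Open Scope ereal_scope.
Context d (T : measurableType d) (R : realType).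
Variables (mu : {measure set T -> \bar R}) (F : nat -> set (set T)).
Hypotheses (sF : forall n, sigma_algebra setT (F n))
  (FM : forall n, F n `<=` measurable) (FS : forall n, F n `<=` F n.+1).
Variables (p : R) (w : T -> R).
Hypotheses (p1 : (1 < p)%R) (w0 : forall x, (0 < w x)%R)
  (mw : measurable_fun setT w).

Local Notation nn v := (forall x : T, 0 <= v x).
Local Notation meas v := (measurable_fun [set: T] v).
Local Notation sg := (dual_weight p w).
Local Notation W := (weighted mu w0 mw).
Local Notation Sg := (weighted mu (dual_weight_gt0 p w0) (measurable_dual_weight p mw)).
Local Notation r := (p - 1)%R.
Local Notation eps := (rdf_eps p).

Hypotheses (sfW : sigma_fin W (F 0%N)) (sfSg : sigma_fin Sg (F 0%N)).

Let p0 : (0 < p)%R. Proof. exact: lt_trans ltr01 p1. Qed.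
Let r0 : (0 < r)%R. Proof. by rewrite subr_gt0. Qed.
Let rn0 : r != 0%R. Proof. by rewrite gt_eqF. Qed.
Let sg0 x : (0 < sg x)%R. Proof. exact: dual_weight_gt0. Qed.
Let msg : measurable_fun setT sg. Proof. exact: measurable_dual_weight. Qed.
Let mEsg : meas (EFin \o sg). Proof. exact/measurable_EFinP. Qed.
Let mEw : meas (EFin \o w). Proof. exact/measurable_EFinP. Qed.
Let mVsg : meas (fun x => ((sg x)^-1)%R%:E).
Proof. exact: measurable_dual_weight_inv. Qed.
Let Vsg0 x : 0 <= ((sg x)^-1)%R%:E. Proof. by rewrite lee_fin invr_ge0 ltW. Qed.
Let Esg0 x : 0 <= (sg x)%:E. Proof. by rewrite lee_fin ltW. Qed.

Let mpow s (v : T -> \bar R) : meas v -> meas (fun x => poweR (v x) s).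
Proof. exact: (measurableT_comp (measurable_poweR s)). Qed.

Let divsg (v : T -> \bar R) x := ((sg x)^-1)%R%:E * v x.

Let divsg0 (v : T -> \bar R) : nn v -> nn (divsg v).
Proof. by move=> v0 x; rewrite mule_ge0. Qed.

Let mdivsg (v : T -> \bar R) : meas v -> meas (divsg v).
Proof. exact: emeasurable_funM. Qed.

Let powr (v : T -> \bar R) x := poweR (v x) r.

Let powr0 (v : T -> \bar R) : nn (powr v). Proof. by move=> x; exact: poweR_ge0. Qed.

Variables (Ew Es : nat -> (T -> \bar R) -> T -> \bar R).
Hypotheses
  (EwP : forall n f, nn f -> meas f -> is_condexp W (F n) f (Ew n f))
  (EsP : forall n f, nn f -> meas f -> is_condexp Sg (F n) f (Es n f)).

Let A (v : T -> \bar R) x := (sg x)%:E * maximal Es (divsg v) x.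
Let B (v : T -> \bar R) x := poweR (maximal Ew (powr v) x) r^-1.

Let Ms0 (v : T -> \bar R) : nn v -> meas v -> nn (maximal Es (divsg v)).
Proof. by move=> v0 mv; apply: (maximal_ge0 EsP); [exact: divsg0|exact: mdivsg]. Qed.

Let mMs (v : T -> \bar R) : nn v -> meas v -> meas (maximal Es (divsg v)).
Proof.
by move=> v0 mv; apply: (measurable_maximal sF FM EsP); [exact: divsg0|exact: mdivsg].
Qed.

Let Mw0 (v : T -> \bar R) : meas v -> nn (maximal Ew (powr v)).
Proof. by move=> mv; apply: (maximal_ge0 EwP); [exact: powr0|exact: mpow]. Qed.

Let mMw (v : T -> \bar R) : meas v -> meas (maximal Ew (powr v)).
Proof.
by move=> mv; apply: (measurable_maximal sF FM EwP); [exact: powr0|exact: mpow].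
Qed.

Let A0 v : nn v -> meas v -> nn (A v).
Proof. by move=> v0 mv x; rewrite mule_ge0//; exact: Ms0. Qed.

Let mA v : nn v -> meas v -> meas (A v).
Proof. by move=> v0 mv; apply: emeasurable_funM => //; exact: mMs. Qed.

Let B0 v : nn (B v). Proof. by move=> x; exact: poweR_ge0. Qed.

Let mB v : meas v -> meas (B v).
Proof. by move=> mv; apply: mpow; exact: mMw. Qed.

Let ndA u v : nn u -> meas u -> nn v -> meas v ->
  {ae mu, forall x, u x <= v x} -> {ae mu, forall x, A u x <= A v x}.
Proof.
move=> u0 mu' v0 mv uv.
have /(weighted_ae (dual_weight_gt0 p w0) (measurable_dual_weight p mw)) duv :
    {ae mu, forall x, divsg u x <= divsg v x}.
  by apply: filterS uv => x uvx; apply: lee_wpmul2l.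
have /ae_weighted := maximal_le_ae sF FM FS sfSg EsP (divsg0 u0) (mdivsg mu')
  (divsg0 v0) (mdivsg mv) duv.
by apply: filterS => x Mx; apply: lee_wpmul2l.
Qed.

Let ndB u v : nn u -> meas u -> nn v -> meas v ->
  {ae mu, forall x, u x <= v x} -> {ae mu, forall x, B u x <= B v x}.
Proof.
move=> u0 mu' v0 mv uv.
have /(weighted_ae w0 mw) duv : {ae mu, forall x, powr u x <= powr v x}.
  by apply: filterS uv => x uvx; apply: le_poweR2r => //; exact: ltW.
have /ae_weighted := maximal_le_ae sF FM FS sfW EwP (@powr0 u) (mpow r mu')
  (@powr0 v) (mpow r mv) duv.
apply: filterS => x Mx; apply: le_poweR2r => //; last exact: Mw0.
by rewrite invr_ge0 ltW.
Qed.

(** Doob's inequality for [sigma mu] with exponent p, transported by the isometry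
    [v |-> v / sigma]. *)
Let bA v : nn v -> meas v -> wnorm mu w p (A v) <= (doob_const p)%:E * wnorm mu w p v.
Proof.
move=> v0 mv; have := maximal_bound sF FM FS sfSg EsP p1 (divsg0 v0) (mdivsg mv).
rewrite (@integral_weighted _ _ _ mu sg _ _
  (fun x => poweR (maximal Es (divsg v) x) p)); last 2 first.
- by move=> x; exact: poweR_ge0.
- by apply: mpow; exact: mMs.
rewrite (@integral_weighted _ _ _ mu sg _ _ (fun x => poweR (divsg v x) p)); last 2 first.
- by move=> x; exact: poweR_ge0.
- by apply: mpow; exact: mdivsg.
congr (_ <= _ * _); apply: eq_integral => x _.
- rewrite /A poweRM//; last exact: Ms0.
  by rewrite poweR_EFin (muleAC (sg x `^ p)%:E) -EFinM dual_weight_powp// muleC.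
- rewrite /divsg poweRM// poweR_EFin (muleAC ((sg x)^-1 `^ p)%:E) -EFinM.
  by rewrite dual_weight_invp// muleC.
Qed.

(** Doob's inequality for [w mu] with the conjugate exponent p / (p - 1), which turns v^(p-1) into
    v^p. *)
Let bB v : nn v -> meas v ->
  wnorm mu w p (B v) <= (doob_const (p / r))%:E * wnorm mu w p v.
Proof.
move=> v0 mv; have := maximal_bound sF FM FS sfW EwP (conjugate_gt1 p1) (@powr0 v) (mpow r mv).
rewrite (@integral_weighted _ _ _ mu w _ _
  (fun x => poweR (maximal Ew (powr v) x) (p / r))); last 2 first.
- by move=> x; exact: poweR_ge0.
- by apply: mpow; exact: mMw.
rewrite (@integral_weighted _ _ _ mu w _ _ (fun x => poweR (powr v x) (p / r))); last 2 first.
- by move=> x; exact: poweR_ge0.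
- by apply: mpow; exact: mpow.
congr (_ <= _ * _); apply: eq_integral => x _.
- by rewrite /B -poweRrM mulrC.
- by rewrite /powr -poweRrM mulrC divfK.
Qed.

(** The inequality [eps S(v k) <= v k.+1] bounds both maximal functions of [v k], hence each of
    their conditional expectations, by the limit [V]. Conditional monotone convergence then replaces
    [v k] by [V] on the left. *)
Lemma exists_weighted_A1 (v0 : T -> \bar R) :
  nn v0 -> meas v0 -> wnorm mu w p v0 < +oo ->
  exists v : T -> \bar R, [/\ meas v, forall x, v0 x <= v x,
    wnorm mu w p v < +oo,
    forall n, {ae mu, forall x, eps%:E * Es n (divsg v) x <= divsg v x}
  & forall n, {ae mu, forall x, (eps `^ r)%:E * Ew n (powr v) x <= powr v x}].
Proof.
move=> v00 mv0 iv0.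
pose S v x := maxe (A v x) (B v x).
have eps0 : (0 < eps)%R by exact: rdf_eps_gt0.
have S0 v : nn v -> meas v -> nn (S v).
  by move=> vn mv x; rewrite /S le_max A0.
have mS v : nn v -> meas v -> meas (S v).
  by move=> vn mv; apply: measurable_maxe; [exact: mA|exact: mB].
have ndS u v : nn u -> meas u -> nn v -> meas v ->
    {ae mu, forall x, u x <= v x} -> {ae mu, forall x, S u x <= S v x}.
  move=> un mu' vn mv uv.
  apply: filterS2 (ndA un mu' vn mv uv) (ndB un mu' vn mv uv) => x Ax Bx.
  by rewrite /S ge_max !le_max Ax Bx orbT.
have bS v : nn v -> meas v ->
    wnorm mu w p (S v) <= (doob_const p + doob_const (p / r))%:E * wnorm mu w p v.
  move=> vn mv.
  apply: le_trans (wnorm_max mu p w0 mw (mA vn mv) (mB mv)) _.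
  rewrite EFinD ge0_muleDl ?lee_fin ?(ltW (doob_const_gt0 _))//; last exact: conjugate_gt1.
  by apply: leeD; [exact: bA|exact: bB].
have [v [vP ndv v0v Sv iv]] :=
  rubio_de_francia w0 mw p0 S0 mS ndS bS eps0 (rdf_epsC p1) v00 mv0 iv0.
have vn k : nn (v k) by have [] := vP k.
have mv k : meas (v k) by have [] := vP k.
pose V x := ereal_sup (range (v ^~ x)).
have vV k x : v k x <= V x by apply: ereal_sup_ubound; exists k.
have V0 : nn V by move=> x; exact: le_trans (vn 0%N x) (vV 0%N x).
have mV : meas V by exact: measurable_fun_ereal_sup.
exists V; split => //; first by move=> x; exact: le_trans (v0v 0%N x) (vV 0%N x).
- move=> n.
  have VE : divsg V = (fun x => ereal_sup (range (fun k => divsg (v k) x))).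
    by apply/funext => x; rewrite /divsg ge0_mule_ereal_sup// invr_gt0.
  have nd k : {ae Sg, forall x, divsg (v k) x <= divsg (v k.+1) x}.
    apply: weighted_ae; apply: filterS (ndv k) => x vx; exact: lee_wpmul2l.
  have := EsP n (divsg0 V0) (mdivsg mV); rewrite {1}VE => EV.
  have /ae_weighted := condexp_ereal_sup_le (sF n) (@FM n)
    (sigma_fin_filtration sF FS sfSg n) (fun k => divsg0 (vn k))
    (fun k => mdivsg (mv k)) nd (fun k => EsP n (divsg0 (vn k)) (mdivsg (mv k))) EV.
  apply: filterS => x Ex.
  have e0 : 0 <= eps%:E by rewrite lee_fin ltW.
  apply: le_trans (lee_wpmul2l e0 Ex) _.
  rewrite ge0_mule_ereal_sup//; apply: ge_ereal_sup => _ [k _ <-].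
  have h : eps%:E * A (v k) x <= V x.
    apply: le_trans (vV k.+1 x); apply: le_trans (Sv k x).
    by apply: lee_wpmul2l; rewrite ?lee_fin ?(ltW eps0)// /S le_max lexx.
  apply: le_trans (_ : ((sg x)^-1)%R%:E * (eps%:E * A (v k) x) <= _); last exact: lee_wpmul2l.
  rewrite /A muleCA (muleA ((sg x)^-1)%R%:E) -EFinM mulVf ?gt_eqF// mul1e.
  by apply: lee_wpmul2l; rewrite ?lee_fin ?(ltW eps0)//; exact: le_maximal.
- move=> n.
  have VE : powr V = (fun x => ereal_sup (range (fun k => powr (v k) x))).
    by apply/funext => x; rewrite /powr poweR_ereal_sup.
  have nd k : {ae W, forall x, powr (v k) x <= powr (v k.+1) x}.
    apply: weighted_ae; apply: filterS (ndv k) => x vx.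
    by apply: le_poweR2r => //; exact: ltW.
  have := EwP n (@powr0 V) (mpow r mV); rewrite {1}VE => EV.
  have /ae_weighted := condexp_ereal_sup_le (sF n) (@FM n)
    (sigma_fin_filtration sF FS sfW n) (fun k => @powr0 (v k))
    (fun k => mpow r (mv k)) nd (fun k => EwP n (@powr0 (v k)) (mpow r (mv k))) EV.
  have er0 : 0 <= (eps `^ r)%:E by rewrite lee_fin powR_ge0.
  apply: filterS => x Ex.
  apply: le_trans (lee_wpmul2l er0 Ex) _.
  have er1 : (0 < eps `^ r)%R by exact: powR_gt0.
  rewrite (ge0_mule_ereal_sup _ er1); apply: ge_ereal_sup => _ [k _ <-].
  have h : eps%:E * B (v k) x <= V x.
    apply: le_trans (vV k.+1 x); apply: le_trans (Sv k x).
    by apply: lee_wpmul2l; rewrite ?lee_fin ?(ltW eps0)// /S le_max lexx orbT.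
  have e0 : 0 <= eps%:E by rewrite lee_fin ltW.
  apply: le_trans (_ : poweR (eps%:E * B (v k) x) r <= _); last first.
    by apply: le_poweR2r => //; [exact: ltW|rewrite mule_ge0//; exact: B0].
  rewrite poweRM//.
  rewrite /B (poweRVK rn0); last exact: Mw0.
  by apply: lee_wpmul2l => //; exact: le_maximal.
Qed.

End weighted_A1.

(** * Bounds on the characteristics *)

Lemma condexp_pullout_in d (T : measurableType d) (R : realType)
    (nu : {measure set T -> \bar R}) (G : set (set T))
    (f g phi : T -> \bar R) (A : set T) :
  sigma_algebra setT G -> G `<=` measurable ->
  (forall x, 0 <= f x)%E -> measurable_fun setT f ->
  is_condexp nu G f g -> (forall x, 0 <= phi x)%E -> submeas G phi -> G A ->
  (\int[nu]_(x in A) (phi x * g x) = \int[nu]_(x in A) (phi x * f x))%E.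
Proof.
move=> sG GM f0 mf fg phi0 mphi GA.
have phiA0 x : (0 <= (phi \_ A) x)%E by exact: erestrict_ge0.
have mphiA : submeas G (phi \_ A).
  have mA := set_submeas GA.
  apply: (@measurable_restrictT _ _ (g_sigma_algebraType G) _ _ phi mA).1.
  exact: measurable_funTS.
have := condexp_pullout sG GM f0 mf fg phiA0 mphiA.
rewrite [in X in _ -> X = _]integral_mkcond [in X in _ -> _ = X]integral_mkcond.
by congr (_ = _); apply: eq_integral => x _; rewrite /patch; case: ifP => //;
  rewrite mul0e.
Qed.

Section A1_bounds.
Local Open Scope ereal_scope.
Context d (T : measurableType d) (R : realType).
Variables (mu : {measure set T -> \bar R}) (G : set (set T)).
Hypotheses (sG : sigma_algebra setT G) (GM : G `<=` measurable)
  (sfG : sigma_fin mu G).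
Variables (p : R) (w : T -> R).
Hypotheses (p1 : (1 < p)%R) (w0 : forall x, (0 < w x)%R)
  (mw : measurable_fun setT w).

Local Notation nn v := (forall x : T, 0 <= v x).
Local Notation meas v := (measurable_fun [set: T] v).
Local Notation sg := (dual_weight p w).
Local Notation W := (weighted mu w0 mw).
Local Notation Sg := (weighted mu (dual_weight_gt0 p w0) (measurable_dual_weight p mw)).
Local Notation r := (p - 1)%R.

Variables (K e : R) (g h v s t : T -> \bar R).
Hypotheses (K0 : (0 < K)%R) (e0 : (0 < e)%R)
  (gP : is_condexp mu G (fun x => (w x)%:E) g)
  (hP : is_condexp mu G (fun x => (sg x)%:E) h)
  (ghK : {ae mu, forall x, g x * poweR (h x) r <= K%:E})
  (v0 : nn v) (mv : meas v)
  (sP : is_condexp Sg G (fun x => ((sg x)^-1)%R%:E * v x) s)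
  (tP : is_condexp W G (fun x => poweR (v x) r) t)
  (es : {ae mu, forall x, e%:E * s x <= ((sg x)^-1)%R%:E * v x})
  (et : {ae mu, forall x, (e `^ r)%:E * t x <= poweR (v x) r}).

Let r0 : (0 < r)%R. Proof. by rewrite subr_gt0. Qed.
Let rn0 : r != 0%R. Proof. by rewrite gt_eqF. Qed.
Let sg0 x : (0 < sg x)%R. Proof. exact: dual_weight_gt0. Qed.
Let msg : measurable_fun setT sg. Proof. exact: measurable_dual_weight. Qed.
Let mEsg : meas (EFin \o sg). Proof. exact/measurable_EFinP. Qed.
Let mEw : meas (EFin \o w). Proof. exact/measurable_EFinP. Qed.
Let Vsg0 x : 0 <= ((sg x)^-1)%R%:E. Proof. by rewrite lee_fin invr_ge0 ltW. Qed.
Let Esg0 x : 0 <= (sg x)%:E. Proof. by rewrite lee_fin ltW. Qed.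
Let Ew0 x : 0 <= (w x)%:E. Proof. by rewrite lee_fin ltW. Qed.
Let mpow a (u : T -> \bar R) : meas u -> meas (fun x => poweR (u x) a).
Proof. exact: (measurableT_comp (measurable_poweR a)). Qed.
Let mVsg : meas (fun x => ((sg x)^-1)%R%:E).
Proof. exact: measurable_dual_weight_inv. Qed.

Let g0 : nn g. Proof. by case: gP. Qed.
Let h0 : nn h. Proof. by case: hP. Qed.
Let s0 : nn s. Proof. by case: sP. Qed.
Let t0 : nn t. Proof. by case: tP. Qed.
Let mg : submeas G g. Proof. by case: gP => _ /(submeasP _ sG). Qed.
Let mh : submeas G h. Proof. by case: hP => _ /(submeasP _ sG). Qed.
Let ms : submeas G s. Proof. by case: sP => _ /(submeasP _ sG). Qed.
Let mt : submeas G t. Proof. by case: tP => _ /(submeasP _ sG). Qed.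
Let sub_meas (u : T -> \bar R) : submeas G u -> meas u.
Proof. exact: submeas_measurable. Qed.

(** Change of measure: over a set of [G], the [G]-measurable [s] passes through [h], giving the
    integral of [s] against [sigma mu], which is that of [v / sigma]. The next lemma does the same
    with [w mu]. *)
Lemma condexp_dual : is_condexp mu G v (fun x => s x * h x).
Proof.
split; first by move=> x; rewrite mule_ge0.
  by apply/(submeasP _ sG); exact: submeasM.
move=> A GA; have mA : measurable A by exact: GM.
rewrite (condexp_pullout_in sG GM Esg0 mEsg hP s0 ms GA).
rewrite -(integral_weighted_in mu sg0 msg mA s0 (sub_meas ms)).
have [_ _ /(_ A GA)] := sP.
rewrite (@integral_weighted_in _ _ _ mu sg _ _ A
  (fun x => ((sg x)^-1)%R%:E * v x)) //; last 2 first.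
- by move=> x; rewrite mule_ge0.
- exact: emeasurable_funM.
move=> E; transitivity (\int[mu]_(x in A) (((sg x)^-1)%R%:E * v x * (sg x)%:E)).
  exact: E.
by apply: eq_integral => x _; rewrite muleAC -EFinM mulVf ?mul1e// gt_eqF.
Qed.

Lemma condexp_primal :
  is_condexp mu G (fun x => (w x)%:E * poweR (v x) r) (fun x => t x * g x).
Proof.
split; first by move=> x; rewrite mule_ge0.
  by apply/(submeasP _ sG); exact: submeasM.
move=> A GA; have mA : measurable A by exact: GM.
rewrite (condexp_pullout_in sG GM Ew0 mEw gP t0 mt GA).
rewrite -(integral_weighted_in mu w0 mw mA t0 (sub_meas mt)).
have [_ _ /(_ A GA)] := tP.
rewrite (@integral_weighted_in _ _ _ mu w _ _ A (fun x => poweR (v x) r)) //; last 2 first.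
- by move=> x; exact: poweR_ge0.
- exact: mpow.
move=> E; transitivity (\int[mu]_(x in A) (poweR (v x) r * (w x)%:E)).
  exact: E.
by apply: eq_integral => x _; rewrite muleC.
Qed.

Let er0 : 0 <= (e `^ r)%:E. Proof. by rewrite lee_fin powR_ge0. Qed.
Let e0' : 0 <= e%:E. Proof. by rewrite lee_fin ltW. Qed.

(** The (p-1)-th power of [es]. As sigma^(1-p) = w, the right side becomes the function conditioned
    in [condexp_primal]. *)
Let es_r : {ae mu, forall x, (e `^ r)%:E * poweR (s x) r <= (w x)%:E * poweR (v x) r}.
Proof.
apply: filterS es => x esx.
rewrite -poweR_EFin -poweRM// -(dual_weight_inv p1 w0 x) -poweR_EFin -poweRM//.
by apply: le_poweR2r => //; [exact: ltW|rewrite mule_ge0].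
Qed.

Let et_r : {ae mu, forall x, e%:E * poweR (t x) r^-1 <= v x}.
Proof.
apply: filterS et => x etx.
rewrite -[leRHS](poweRK rn0 (v0 x)).
have -> : e%:E = poweR (e `^ r)%:E r^-1.
  by rewrite -poweR_EFin (poweRK rn0).
rewrite -poweRM//; apply: le_poweR2r; [by rewrite invr_ge0 ltW|by rewrite mule_ge0|].
exact: etx.
Qed.

(** Conditioning [es_r] on [G] leaves the [G]-measurable left side unchanged and turns the right
    side into [t * g]. The same argument takes [et_r] to [et_sh]. *)
Let es_tg : {ae mu, forall x, (e `^ r)%:E * poweR (s x) r <= t x * g x}.
Proof.
have [_ _ tg] := condexp_primal.
apply: (submeas_le_ae sG GM sfG).
- by move=> x; rewrite mule_ge0// poweR_ge0.
- by move=> x; rewrite mule_ge0.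
- by apply: submeasM; [exact: measurable_cst|exact: submeas_poweR].
- exact: submeasM.
move=> A GA; have mA : measurable A by exact: GM.
rewrite tg//; apply: ae_ge0_le_integral => //.
- by move=> x _; rewrite mule_ge0// poweR_ge0.
- apply: measurable_funTS; apply: emeasurable_funM; first exact: measurable_cst.
  by apply: mpow; exact: sub_meas.
- by move=> x _; rewrite mule_ge0// poweR_ge0.
- by apply: measurable_funTS; apply: emeasurable_funM => //; exact: mpow.
by apply: filterS es_r => x h1 _.
Qed.

Let et_sh : {ae mu, forall x, e%:E * poweR (t x) r^-1 <= s x * h x}.
Proof.
have [_ _ sh] := condexp_dual.
apply: (submeas_le_ae sG GM sfG).
- by move=> x; rewrite mule_ge0// poweR_ge0.
- by move=> x; rewrite mule_ge0.
- by apply: submeasM; [exact: measurable_cst|exact: submeas_poweR].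
- exact: submeasM.
move=> A GA; have mA : measurable A by exact: GM.
rewrite sh//; apply: ae_ge0_le_integral => //.
- by move=> x _; rewrite mule_ge0// poweR_ge0.
- apply: measurable_funTS; apply: emeasurable_funM; first exact: measurable_cst.
  by apply: mpow; exact: sub_meas.
- exact: measurable_funTS.
by apply: filterS et_r => x h1 _.
Qed.

(** With r = p - 1, (e^2 s h)^r <= e^r (t g) h^r <= K e^r t <= K v^r, by [es_tg], the A_p bound and
    [et]. The r-th root produces the exponent 1 / (p - 1) on [K]. *)
Lemma A1_bound_dual :
  {ae mu, forall x, (e ^+ 2)%:E * (s x * h x) <= (K `^ r^-1)%:E * v x}.
Proof.
apply: filterS3 es_tg et ghK => x h1 h2 h3.
have hr0 : 0 <= poweR (h x) r by exact: poweR_ge0.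
have KE : 0 <= K%:E by rewrite lee_fin ltW.
have step : poweR ((e ^+ 2)%:E * (s x * h x)) r <= K%:E * poweR (v x) r.
  rewrite expr2 EFinM !poweRM ?mule_ge0// poweR_EFin.
  have -> : (e `^ r)%:E * (e `^ r)%:E * (poweR (s x) r * poweR (h x) r) =
    (e `^ r)%:E * (((e `^ r)%:E * poweR (s x) r) * poweR (h x) r) by rewrite !muleA.
  apply: le_trans (lee_wpmul2l er0 (lee_wpmul2r hr0 h1)) _.
  rewrite -(muleA (t x)).
  apply: le_trans (lee_wpmul2l er0 (lee_wpmul2l (t0 x) h3)) _.
  rewrite muleA muleC; exact: lee_wpmul2l.
have e20 : 0 <= (e ^+ 2)%:E * (s x * h x).
  by rewrite mule_ge0 ?mule_ge0// lee_fin exprn_ge0// ltW.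
have -> : (K `^ r^-1)%:E * v x = poweR (K%:E * poweR (v x) r) r^-1.
  by rewrite poweRM ?poweR_ge0// poweRK.
rewrite -(poweRK rn0 e20).
by apply: le_poweR2r => //; [rewrite invr_ge0 ltW|exact: poweR_ge0].
Qed.

(** With r = p - 1, e^(2r) t g <= e^r s^r h^r g <= w v^r h^r g <= K w v^r, by [et_sh], [es_r] and
    the A_p bound; no root is taken, so [K] enters linearly. *)
Lemma A1_bound_primal : {ae mu, forall x,
  ((e `^ r) ^+ 2)%:E * (t x * g x) <= K%:E * ((w x)%:E * poweR (v x) r)}.
Proof.
apply: filterS3 et_sh es_r ghK => x h1 h2 h3.
have hr0 : 0 <= poweR (h x) r by exact: poweR_ge0.
have step : (e `^ r)%:E * t x <= poweR (s x) r * poweR (h x) r.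
  have -> : (e `^ r)%:E * t x = poweR (e%:E * poweR (t x) r^-1) r.
    by rewrite poweRM ?poweR_ge0// poweRVK.
  rewrite -poweRM//; apply: le_poweR2r => //; first exact: ltW.
  by rewrite mule_ge0// poweR_ge0.
rewrite expr2 EFinM.
have -> : (e `^ r)%:E * (e `^ r)%:E * (t x * g x) =
  (e `^ r)%:E * ((e `^ r)%:E * t x) * g x by rewrite !muleA.
apply: le_trans (lee_wpmul2r (g0 x) (lee_wpmul2l er0 step)) _.
rewrite muleA; apply: le_trans (lee_wpmul2r (g0 x) (lee_wpmul2r hr0 h2)) _.
rewrite -muleA (muleC (poweR (h x) r)) [leRHS]muleC.
by apply: lee_wpmul2l => //; rewrite mule_ge0// poweR_ge0.
Qed.

End A1_bounds.

(** * Sigma-finiteness on [F 0] and positivity of conditional expectations *)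

Lemma filtration_sigma_fin d (T : measurableType d) (R : realType)
    (mu : {measure set T -> \bar R}) (G : set (set T)) (S : nat -> set T) :
  sigma_algebra setT G -> G `<=` measurable ->
  (forall k, G (S k) /\ (mu (S k) < +oo)%E) -> \bigcup_k S k = setT ->
  sigma_fin mu G.
Proof.
move=> sG GM SP ST.
have S0 k : 0 < 1 + fine (mu (S k)) by rewrite ltr_wpDr// fine_ge0.
(* The powers of 2 keep the sum of the [c k] times the indicator of [S k] at most 1 pointwise;
   dividing by [1 + mu (S k)] keeps its integral at most 1. *)
pose c k : R := (1 / 2 ^+ k.+1) / (1 + fine (mu (S k))).
have c0 k : 0 < c k by rewrite divr_gt0// divr_gt0// exprn_gt0.
have ck k : c k <= 1 / 2 ^+ k.+1.
  rewrite ler_pdivrMr// ler_peMr ?divr_ge0 ?exprn_ge0//.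
  by rewrite lerDl fine_ge0.
pose f k x := (c k * \1_(S k) x)%:E.
have f0 k x : (0 <= f k x)%E by rewrite lee_fin mulr_ge0// ltW.
have mf k : submeas G (f k).
  have mS : measurable (S k : set (g_sigma_algebraType G)).
    by apply: set_submeas; have [] := SP k.
  apply/measurable_EFinP; apply: measurable_funM; first exact: measurable_cst.
  exact: (@measurable_indic _ (g_sigma_algebraType G) R setT (S k) mS).
have half : (\sum_(k <oo) (1 / 2 ^+ k.+1)%:E <= (1 : R)%:E)%E.
  apply: le_trans (epsilon_trick0 xpredT (ler01 : 0 <= (1 : R))).
  by apply: lee_nneseries => k _ //; rewrite natrX.
have f1 x : (\sum_(k <oo) f k x <= 1)%E.
  apply: le_trans half; apply: lee_nneseries => k _ //.
  rewrite /f lee_fin indicE; case: (_ \in _); rewrite ?mulr1// mulr0.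
  by rewrite divr_ge0// exprn_ge0.
have ffin x : (\sum_(k <oo) f k x)%E \is a fin_num.
  rewrite ge0_fin_numE; first exact: le_lt_trans (f1 x) (ltry _).
  exact: nneseries_ge0.
exists (fun x => fine (\sum_(k <oo) f k x)%E); split.
- move=> x; have [k _ Skx] : (\bigcup_k S k) x by rewrite ST.
  rewrite -lte_fin fineK//.
  apply: (@lt_le_trans _ _ (\sum_(0 <= i < k.+1) f i x)%E); last exact: nneseries_lim_ge.
  rewrite big_nat_recr//=; apply: (@lt_le_trans _ _ (f k x)).
    by rewrite lte_fin indicE mem_set// mulr1.
  by rewrite leeDr// sume_ge0.
- rewrite (_ : _ \o _ = fun x => (\sum_(k <oo) f k x)%E).
    apply: (@ge0_emeasurable_sum _ (g_sigma_algebraType G) R setT f xpredT) => //.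
    by move=> k _; exact: mf.
  by apply/funext => x /=; rewrite fineK.
- rewrite (eq_integral (fun x => (\sum_(k <oo) f k x)%E)); last first.
    by move=> x _; rewrite fineK.
  have Tmf k := submeas_measurable sG GM (mf k).
  rewrite integral_nneseries//.
  apply: (@le_lt_trans _ _ 1%:E); last exact: ltry.
  apply: le_trans half; apply: lee_nneseries => [k _ _|k _].
    by apply: integral_ge0 => x _; exact: f0.
  have [/GM mS fS] := SP k.
  rewrite /f; under eq_integral do rewrite EFinM.
  rewrite ge0_integralZl//; last 2 first.
  - by apply/measurable_EFinP; exact: measurable_indic.
  - by rewrite lee_fin ltW.
  rewrite integral_indic// setIT.
  have mufin : mu (S k) \is a fin_num by rewrite ge0_fin_numE.
  rewrite -(fineK mufin) -EFinM lee_fin /c mulrAC ler_pdivrMr//.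
  by rewrite ler_wpM2l ?divr_ge0 ?exprn_ge0// lerDr.
Qed.

(** The set where [g] vanishes belongs to [G], so the positive [f] has integral 0 over it. *)
Lemma condexp_gt0 d (T : measurableType d) (R : realType)
    (mu : {measure set T -> \bar R}) (G : set (set T)) (f : T -> R)
    (g : T -> \bar R) :
  sigma_algebra setT G -> G `<=` measurable ->
  (forall x, 0 < f x) -> measurable_fun setT f ->
  is_condexp mu G (fun x => (f x)%:E) g -> {ae mu, forall x, (0 < g x)%E}.
Proof.
move=> sG GM f0 mf [g0 /(submeasP _ sG) mg fg].
have GA : G [set x | (g x <= 0)%E] by apply: submeas_le => //; exact: measurable_cst.
have mA : measurable [set x | (g x <= 0)%E] by exact: GM.
have : mu.-negligible [set x | (g x <= 0)%E].
  apply: (@integral_le0_negligible _ _ _ mu _ (fun x => (f x)%:E)) => //.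
  - by apply: measurable_funTS; exact/measurable_EFinP.
  - by move=> x _; rewrite lte_fin.
  - have := fg _ GA; rewrite integral0_eq => [<- //|x /= gx].
    by apply/le_anti; rewrite gx g0.
by apply: negligibleS => x /= /negP; rewrite -leNgt.
Qed.

(** * From an a.e. finite function with an A_1 bound to an integrable A_1 weight; used for both
    factors *)

Section normalized_weight.
Local Open Scope ereal_scope.
Context d (T : measurableType d) (R : realType).
Variables (mu : {measure set T -> \bar R}) (F : nat -> set (set T)).
Hypotheses (sF : forall n, sigma_algebra setT (F n))
  (FM : forall n, F n `<=` measurable) (FS : forall n, F n `<=` F n.+1).
Variables (psi : T -> R).
Hypotheses (psi0 : forall x, (0 < psi x)%R) (mpsi : submeas (F 0%N) (EFin \o psi))
  (ipsi : \int[mu]_x (psi x)%:E < +oo).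
Variables (U : T -> \bar R) (u phi : T -> R) (k : nat -> T -> \bar R) (c B : R).
Hypotheses (U0 : forall x, 0 <= U x) (mU : measurable_fun setT U)
  (u0 : forall x, (0 < u x)%R) (mu_ : measurable_fun setT u)
  (Uu : {ae mu, forall x, U x = (u x)%:E})
  (kP : forall n, is_condexp mu (F n) U (k n))
  (c0 : (0 < c)%R) (kU : forall n, {ae mu, forall x, c%:E * k n x <= B%:E * U x})
  (phi0 : forall x, (0 < phi x)%R) (mphi : submeas (F 0%N) (EFin \o phi))
  (phi_psi : forall x, (phi x * (1 + fine (k 0%N x)) <= psi x)%R).

Let sub_meas n (g : T -> \bar R) : submeas (F n) g -> measurable_fun setT g.
Proof. exact: submeas_measurable (sF n) (@FM n). Qed.
Let mphin n : submeas (F n) (EFin \o phi).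
Proof. by elim: n => // n; exact: submeasS (sF n) (sF n.+1) (@FS n). Qed.
Let Ephi0 x : 0 <= (phi x)%:E. Proof. by rewrite lee_fin ltW. Qed.
Let k0 n x : 0 <= k n x. Proof. by have [] := kP n. Qed.
Let mk n : submeas (F n) (k n).
Proof. by have [_ /(submeasP _ (sF n))] := kP n. Qed.
Let mEu : measurable_fun setT (EFin \o u). Proof. exact/measurable_EFinP. Qed.
Let Tphi : measurable_fun setT phi.
Proof. by apply/measurable_EFinP; exact: sub_meas mphi. Qed.

Lemma condexp_normalized n :
  is_condexp mu (F n) (fun x => (u x * phi x)%:E) (fun x => (phi x)%:E * k n x).
Proof.
split; first by move=> x; rewrite mule_ge0.
  by apply/(submeasP _ (sF n)); apply: (@submeasM _ T R (F n) (EFin \o phi)).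
move=> A GA; have mA : measurable A by exact: FM GA.
rewrite (condexp_pullout_in (sF n) (@FM n) U0 mU (kP n) Ephi0 (@mphin n) GA).
apply: ge0_ae_eq_integral => //.
- apply: measurable_funTS; apply: emeasurable_funM => //; exact: sub_meas mphi.
- apply: measurable_funTS; apply/measurable_EFinP; exact: measurable_funM.
- by move=> x _; rewrite mule_ge0.
- by move=> x _; rewrite lee_fin ltW// mulr_gt0.
- by apply: filterS Uu => x -> _; rewrite -EFinM mulrC.
Qed.

(** The integral of [u phi] equals that of [phi * k 0], which [phi_psi] bounds by that of [psi]; the
    A_1 bound makes [k 0] finite a.e. The weight lies in L_1, so its bounded part is taken to be
    0. *)
Lemma is_weight_normalized : is_weight mu (fun x => u x * phi x)%R.
Proof.
have mw : measurable_fun setT (fun x => u x * phi x)%R by exact: measurable_funM.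
split=> //; first by move=> x; rewrite mulr_gt0.
exists (fun x => u x * phi x)%R, (cst 0%R); split.
- apply/integrableP; split; first exact/measurable_EFinP.
  under eq_integral => x _ do rewrite gee0_abs ?lee_fin ?(ltW (mulr_gt0 (u0 x) (phi0 x)))//.
  have FT : F 0%N setT.
    rewrite -(sigma_algebra_id (sF 0%N)).
    exact: (@measurableT _ (g_sigma_algebraType (F 0%N))).
  have [_ _ /(_ _ FT) E] := condexp_normalized 0%N.
  apply: (@le_lt_trans _ _ (\int[mu]_x ((phi x)%:E * k 0%N x))).
    by rewrite -E.
  apply: le_lt_trans ipsi; apply: ae_ge0_le_integral => //.
  + by move=> x _; rewrite mule_ge0.
  + by apply: emeasurable_funM; [exact: sub_meas mphi|exact: sub_meas (@mk 0%N)].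
  + by move=> x _; rewrite lee_fin ltW.
  + exact: sub_meas mpsi.
  apply: filterS2 Uu (kU 0%N) => x Ux kx _.
  have kf : k 0%N x \is a fin_num.
    rewrite ge0_fin_numE//; rewrite Ux -EFinM in kx.
    have := le_lt_trans kx (ltry _); case: (k 0%N x) => //.
      by move=> a _; exact: ltry.
    by rewrite gt0_muley ?lte_fin.
  rewrite -(fineK kf) -EFinM lee_fin; apply: le_trans (phi_psi x).
  by rewrite ler_wpM2l ?(ltW (phi0 x))// lerDr.
- exact: measurable_cst.
- by exists 0%R; apply: aeW => x; rewrite normr0.
- by apply: aeW => x; rewrite addr0.
Qed.

Lemma A1_char_normalized :
  A1_char mu F (fun x => u x * phi x)%R <= (B / c)%:E.
Proof.
apply: ereal_inf_lbound; exists (B / c)%R => //= n.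
exists (fun x => (phi x)%:E * k n x); split; first exact: condexp_normalized.
apply: filterS2 Uu (kU n) => x Ux kx; rewrite Ux -EFinM in kx.
have kx' : k n x <= (B / c * u x)%:E.
  case: (k n x) (k0 n x) kx => [a| |] // _; last by rewrite gt0_muley ?lte_fin.
  by rewrite -EFinM !lee_fin mulrAC ler_pdivlMr// mulrC.
apply: le_trans (lee_wpmul2l (Ephi0 x) kx') _.
by rewrite -EFinM lee_fin mulrCA (mulrC (phi x)).
Qed.

End normalized_weight.

(** * Factorization *)

Section factorization.
Local Open Scope ereal_scope.
Context d (T : measurableType d) (R : realType).
Variables (mu : {measure set T -> \bar R}) (F : nat -> set (set T)).
Hypotheses (sF : forall n, sigma_algebra setT (F n))
  (FM : forall n, F n `<=` measurable) (FS : forall n, F n `<=` F n.+1)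
  (sfF : sigma_fin mu (F 0%N)).
Variables (p : R) (w : T -> R).
Hypotheses (p1 : (1 < p)%R) (w0 : forall x, (0 < w x)%R)
  (mw : measurable_fun setT w).

Local Notation sg := (dual_weight p w).
Local Notation W := (weighted mu w0 mw).
Local Notation Sg := (weighted mu (dual_weight_gt0 p w0) (measurable_dual_weight p mw)).
Local Notation r := (p - 1)%R.
Local Notation e := (rdf_eps p).

Variables (K : R) (g h : nat -> T -> \bar R).
Hypotheses (K0 : (0 < K)%R)
  (gP : forall n, is_condexp mu (F n) (fun x => (w x)%:E) (g n))
  (hP : forall n, is_condexp mu (F n) (fun x => (sg x)%:E) (h n))
  (ghK : forall n, {ae mu, forall x, g n x * poweR (h n x) r <= K%:E}).

Let r0 : (0 < r)%R. Proof. by rewrite subr_gt0. Qed.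
Let rn0 : r != 0%R. Proof. by rewrite gt_eqF. Qed.
Let p0 : (0 < p)%R. Proof. exact: lt_trans ltr01 p1. Qed.
Let e0 : (0 < e)%R. Proof. exact: rdf_eps_gt0. Qed.

(** The other factor of the A_p product is positive a.e., so an infinite value would contradict the
    bound [K]. This makes [w mu] sigma-finite on [F 0]; [h_lty] does so for [sigma mu]. *)
Let g_lty : {ae mu, forall x, g 0%N x < +oo}.
Proof.
have h0 := condexp_gt0 (sF 0%N) (@FM 0%N) (dual_weight_gt0 p w0)
  (measurable_dual_weight p mw) (hP 0%N).
apply: filterS2 (ghK 0%N) h0 => x gx hx; rewrite ltNge leye_eq; apply/eqP => E.
by move: gx; rewrite E gt0_mulye ?poweR_gt0// leye_eq.
Qed.

Let h_lty : {ae mu, forall x, h 0%N x < +oo}.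
Proof.
have g0 := condexp_gt0 (sF 0%N) (@FM 0%N) w0 mw (gP 0%N).
apply: filterS2 (ghK 0%N) g0 => x hx gx; rewrite ltNge leye_eq; apply/eqP => E.
by move: hx; rewrite E poweRyr// gt0_muley// leye_eq.
Qed.

Lemma factorization_of_bound : exists w1 w2 : T -> R,
  [/\ is_weight mu w1, is_weight mu w2,
      forall x, w x = (w1 x * w2 x `^ (1 - p))%R,
      A1_char mu F w1 <= (K / (e `^ r) ^+ 2)%:E
    & A1_char mu F w2 <= (K `^ r^-1 / e ^+ 2)%:E].
Proof.
have sfW : sigma_fin W (F 0%N).
  exact: (sigma_fin_weighted w0 mw (sF 0%N) (@FM 0%N) sfF (gP 0%N) g_lty).
have sfSg : sigma_fin Sg (F 0%N).
  exact: (sigma_fin_weighted (dual_weight_gt0 p w0) (measurable_dual_weight p mw)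
    (sF 0%N) (@FM 0%N) sfF (hP 0%N) h_lty).
have [Ew EwP] := condexp_operator sF FM FS sfW.
have [Es EsP] := condexp_operator sF FM FS sfSg.
have [psi [psi0 mpsi ipsi]] := sfF.
have [psiW [psiW0 mpsiW ipsiW]] := sfW.
have TpsiW : measurable_fun setT psiW.
  by apply/measurable_EFinP; exact: submeas_measurable (sF 0%N) (@FM 0%N) mpsiW.
(* A positive starting point of finite norm: [wnorm] of [v0] is the integral of [psiW] against
   [w mu]. *)
pose v0 x := (psiW x `^ p^-1)%R.
have v00 x : (0 < v0 x)%R by rewrite powR_gt0.
have Tv0 : measurable_fun setT v0 by exact: (measurableT_comp (measurable_powR _)).
have iv0 : wnorm mu w p (fun x => (v0 x)%:E) < +oo.
  apply: le_lt_trans ipsiW; rewrite integral_weighted; last 2 first.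
  - by move=> x; rewrite lee_fin ltW.
  - exact/measurable_EFinP.
  rewrite /wnorm le_eqVlt; apply/orP; left; apply/eqP; apply: eq_integral => x _.
  by rewrite poweR_EFin /v0 -powRrM mulVf ?gt_eqF// powRr1// ltW.
have v0E0 x : 0 <= (v0 x)%:E by rewrite lee_fin ltW.
have [v [mv v0v iv esv etv]] := exists_weighted_A1 sF FM FS p1 sfW sfSg EwP EsP
  v0E0 ((measurable_EFinP _ _).2 Tv0) iv0.
have vn x : 0 <= v x by exact: le_trans (v0E0 x) (v0v x).
have mvr : measurable_fun setT (fun x => poweR (v x) r).
  exact: (measurableT_comp (measurable_poweR r)).
have msg : measurable_fun setT sg by exact: measurable_dual_weight.
pose dv x := ((sg x)^-1)%R%:E * v x.
have dv0 x : 0 <= dv x.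
  by rewrite mule_ge0// lee_fin invr_ge0 ltW// dual_weight_gt0.
have mdv : measurable_fun setT dv.
  by apply: emeasurable_funM mv; exact: measurable_dual_weight_inv.
pose s n := Es n dv; pose t n := Ew n (fun x => poweR (v x) r).
have sP n : is_condexp Sg (F n) dv (s n) by exact: EsP.
have tP n : is_condexp W (F n) (fun x => poweR (v x) r) (t n).
  by apply: EwP => // x; exact: poweR_ge0.
have sfn n := sigma_fin_filtration sF FS sfF n.
have k2P n : is_condexp mu (F n) v (fun x => s n x * h n x).
  exact: (condexp_dual (sF n) (@FM n) (hP n) vn mv (sP n)).
have k1P n : is_condexp mu (F n) (fun x => (w x)%:E * poweR (v x) r)
    (fun x => t n x * g n x).
  exact: (condexp_primal (sF n) (@FM n) (gP n) mv (tP n)).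
have k2v n : {ae mu, forall x,
    (e ^+ 2)%:E * (s n x * h n x) <= (K `^ r^-1)%:E * v x}.
  exact: (A1_bound_dual (sF n) (@FM n) (sfn n) p1 K0 e0 (gP n) (hP n) (ghK n)
    vn mv (sP n) (tP n) (esv n) (etv n)).
have k1v n : {ae mu, forall x,
    ((e `^ r) ^+ 2)%:E * (t n x * g n x) <= K%:E * ((w x)%:E * poweR (v x) r)}.
  exact: (A1_bound_primal (sF n) (@FM n) (sfn n) p1 e0 (gP n) (hP n) (ghK n)
    vn mv (sP n) (tP n) (esv n) (etv n)).
(* A real version of [v] that is positive everywhere: [v >= v0], and [v0] takes over where [v] is
   infinite, a null set because [wnorm] of [v] is finite. *)
pose vr x := Num.max (fine (v x)) (v0 x).
have vr0 x : (0 < vr x)%R by rewrite lt_max v00 orbT.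
have mvr' : measurable_fun setT vr.
  apply: measurable_maxr => //.
  exact: (measurableT_comp (fine_measurable measurableT)).
have vvr : {ae mu, forall x, v x = (vr x)%:E}.
  have : mu.-integrable setT (fun x => poweR (v x) p * (w x)%:E).
    apply/integrableP; split.
      apply: emeasurable_funM; first exact: (measurableT_comp (measurable_poweR p)).
      exact/measurable_EFinP.
    rewrite (eq_integral (fun x => poweR (v x) p * (w x)%:E))// => x _.
    by rewrite gee0_abs// mule_ge0 ?poweR_ge0// lee_fin ltW.
  move=> /(integrable_ae measurableT); apply: filterS => x /(_ I) vwf.
  have vf : v x \is a fin_num.
    rewrite ge0_fin_numE// ltNge leye_eq; apply/eqP => E.
    by move: vwf; rewrite E poweRyr ?gt_eqF// gt0_mulye ?lte_fin.
  rewrite /vr max_l ?fineK//.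
  by rewrite -lee_fin fineK.
pose k2 x := s 0%N x * h 0%N x; pose k1 x := t 0%N x * g 0%N x.
have mk2 : submeas (F 0%N) k2 by have [_ /(submeasP _ (sF 0%N))] := k2P 0%N.
have mk1 : submeas (F 0%N) k1 by have [_ /(submeasP _ (sF 0%N))] := k1P 0%N.
have k20 x : (0 < 1 + fine (k2 x))%R.
  by rewrite ltr_wpDr// fine_ge0//; have [+ _ _] := k2P 0%N; apply.
have k10 x : (0 < 1 + fine (k1 x))%R.
  by rewrite ltr_wpDr// fine_ge0//; have [+ _ _] := k1P 0%N; apply.
pose a2 x := (psi x * (1 + fine (k2 x)) `^ (-1))%R.
pose a1 x := (psi x * (1 + fine (k1 x)) `^ (-1))%R.
have a20 x : (0 < a2 x)%R by rewrite mulr_gt0// powR_gt0.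
have a10 x : (0 < a1 x)%R by rewrite mulr_gt0// powR_gt0.
(* A single [phi] must make [phi v] and [w (phi v)^(p-1)] integrable, so that it cancels in the
   product; [a2] serves the former, [a1] the latter. *)
pose phi x := Num.min (a2 x) (a1 x `^ r^-1)%R.
have phi0 x : (0 < phi x)%R by rewrite lt_min a20 powR_gt0.
have mphi : submeas (F 0%N) (EFin \o phi).
  have ma2 := submeas_quotient mpsi mk2; have ma1 := submeas_quotient mpsi mk1.
  apply/measurable_EFinP; apply: measurable_minr; first exact/measurable_EFinP.
  apply: (measurableT_comp (measurable_powR _)); exact/measurable_EFinP.
have phi_r0 x : (0 < phi x `^ r)%R by rewrite powR_gt0.
have mphi_r : submeas (F 0%N) (EFin \o (fun x => phi x `^ r)%R).
  by apply: (@submeas_poweR _ T R (F 0%N) (EFin \o phi) r mphi).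
have phi_psi2 x : (phi x * (1 + fine (k2 x)) <= psi x)%R.
  rewrite -ler_pdivlMr//; apply: (@le_trans _ _ (a2 x)); first by rewrite ge_min lexx.
  by rewrite /a2 powR_inv1// ltW.
have phi_psi1 x : (phi x `^ r * (1 + fine (k1 x)) <= psi x)%R.
  rewrite -ler_pdivlMr//; apply: (@le_trans _ _ (a1 x)); last first.
    by rewrite /a1 powR_inv1// ltW.
  have -> : a1 x = ((a1 x `^ r^-1) `^ r)%R by rewrite -powRrM mulVf// powRr1// ltW.
  apply: ge0_ler_powR; rewrite ?nnegrE ?powR_ge0 ?(ltW r0) ?(ltW (phi0 x))//.
  by rewrite ge_min lexx orbT.
pose U1 x := (w x)%:E * poweR (v x) r; pose u1 x := (w x * vr x `^ r)%R.
have U10 x : 0 <= U1 x by rewrite mule_ge0 ?poweR_ge0// lee_fin ltW.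
have mU1 : measurable_fun setT U1.
  by apply: emeasurable_funM => //; exact/measurable_EFinP.
have u10 x : (0 < u1 x)%R by rewrite mulr_gt0// powR_gt0.
have mu1 : measurable_fun setT u1.
  by apply: measurable_funM => //; exact: (measurableT_comp (measurable_powR r)).
have Uu1 : {ae mu, forall x, U1 x = (u1 x)%:E}.
  by apply: filterS vvr => x vx; rewrite /U1 vx.
have ee2 : (0 < e ^+ 2)%R by rewrite exprn_gt0.
have er2 : (0 < (e `^ r) ^+ 2)%R by rewrite exprn_gt0// powR_gt0.
exists (fun x => u1 x * phi x `^ r)%R, (fun x => vr x * phi x)%R; split.
- exact: (is_weight_normalized sF FM FS psi0 mpsi ipsi U10 mU1 u10 mu1 Uu1 k1P er2 k1v
    phi_r0 mphi_r phi_psi1).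
- exact: (is_weight_normalized sF FM FS psi0 mpsi ipsi vn mv vr0 mvr' vvr k2P ee2 k2v
    phi0 mphi phi_psi2).
- move=> x; have -> : (u1 x * phi x `^ r = w x * (vr x * phi x) `^ r)%R.
    by rewrite /u1 powRM ?(ltW (vr0 x)) ?(ltW (phi0 x))// mulrA.
  have -> : (1 - p = - r)%R by rewrite opprB.
  by rewrite powRN -mulrA mulfV ?mulr1// gt_eqF// powR_gt0// mulr_gt0.
- exact: (A1_char_normalized sF FM FS U10 mU1 u10 mu1 Uu1 k1P er2 k1v phi_r0 mphi_r).
- exact: (A1_char_normalized sF FM FS vn mv vr0 mvr' vvr k2P ee2 k2v phi0 mphi).
Qed.

End factorization.

(** * The zero measure and positivity of the A_p characteristic *)

Section Ap_char.
Local Open Scope ereal_scope.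
Context d (T : measurableType d) (R : realType).
Variables (mu : {measure set T -> \bar R}) (F : nat -> set (set T)) (p : R) (w : T -> R).
Hypotheses (sF : forall n, sigma_algebra setT (F n)) (FM : forall n, F n `<=` measurable).

Lemma is_weight_cst1 : is_weight mu (fun _ : T => 1%R).
Proof.
split => //.
exists (cst 0%R), (cst 1%R); split.
- by rewrite (_ : _ \o _ = cst 0)//; exact: integrable0.
- exact: measurable_cst.
- by exists 1%R; apply: aeW => x; rewrite normr1.
- by apply: aeW => x; rewrite add0r.
Qed.

(* For the zero measure the infimum defining the characteristic runs over all
   real constants, negative ones included. *)
Lemma A1_char_null (u : T -> R) : measurable_fun setT u -> (forall x, (0 <= u x)%R) ->
  {ae mu, forall x : T, False} -> A1_char mu F u = -oo.
Proof.
move=> mu_ u0 mu0; suff AK K : A1_char mu F u <= K%:E.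
  case E : (A1_char mu F u) (AK (fine (A1_char mu F u) - 1)%R) => [a| |] //=.
  by rewrite lee_fin lerBrDl gerDr ler10.
apply: ereal_inf_lbound; exists K => //= n.
exists (cst 0); split; last by apply: filterS mu0.
split => //; first by apply/(submeasP _ (sF n)); exact: measurable_cst.
move=> A GA; have mA : measurable A by exact: FM GA.
apply: ge0_ae_eq_integral => //.
- by apply: measurable_funTS; exact/measurable_EFinP.
- by move=> x _; rewrite lee_fin.
- by apply: filterS mu0.
Qed.

(** Both characteristics are [-oo], so any bounds [a] and [b] hold. This case is split off because
    the A_p characteristic has no positive lower bound in it. *)
Lemma factorization_null (a b : \bar R) : {ae mu, forall x : T, False} ->
  exists w1 w2 : T -> R, [/\ is_weight mu w1, is_weight mu w2,
    {ae mu, forall x, w x = (w1 x * w2 x `^ (1 - p))%R},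
    A1_char mu F w1 <= a & A1_char mu F w2 <= b].
Proof.
move=> mu0; exists (fun=> 1%R), (fun=> 1%R); split.
- exact: is_weight_cst1.
- exact: is_weight_cst1.
- by apply: filterS mu0.
- by rewrite A1_char_null ?leNye.
- by rewrite A1_char_null ?leNye.
Qed.

Hypotheses (sfF : sigma_fin mu (F 0%N)) (p1 : (1 < p)%R)
  (w0 : forall x, (0 < w x)%R) (mw : measurable_fun setT w).

(** Admissible constants arbitrarily close to 0 would force the A_p product at [n = 0] to be at most
    0 a.e., whereas both of its factors are positive a.e. *)
Lemma Ap_char_gt0 : ~ {ae mu, forall x : T, False} ->
  Ap_char mu F p w < +oo -> exists2 Q : R, (0 < Q)%R & Ap_char mu F p w = Q%:E.
Proof.
move=> mu0 Ap; have := Ap; rewrite {1}/Ap_char.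
set SK := (X in ereal_inf [set _ | _ in X]) => /ereal_inf_lt[_ [K0 K0P _] _].
have [g [h [gP hP gh]]] := K0P 0%N.
have r0 : (0 <= p - 1)%R by rewrite subr_ge0 ltW.
have [g0 _ _] := gP; have [h0 _ _] := hP.
have msg := measurable_dual_weight p mw.
have gpos := condexp_gt0 (sF 0%N) (@FM 0%N) w0 mw gP.
have hpos := condexp_gt0 (sF 0%N) (@FM 0%N) (dual_weight_gt0 p w0) msg hP.
have [dl dl0 dlK] : exists2 dl : R, (0 < dl)%R & forall K, SK K -> (dl <= K)%R.
  apply: contrapT => ndl; apply: mu0.
  have /ae_foralln small : forall j : nat,
      {ae mu, forall x, g x * poweR (h x) (p - 1) <= (j.+1%:R^-1)%:E}.
    move=> j; have [K KP Kj] : exists2 K, SK K & (K < j.+1%:R^-1)%R.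
      apply: contrapT => nK; apply: ndl; exists (j.+1%:R^-1)%R => // K KP.
      by rewrite leNgt; apply/negP => Kj; apply: nK; exists K.
    have [g' [h' [gP' hP' gh']]] := KP 0%N.
    have w0' x : 0 <= (w x)%:E by rewrite lee_fin ltW.
    have mEw : measurable_fun setT (fun x => (w x)%:E) by exact/measurable_EFinP.
    have s0' x : 0 <= (dual_weight p w x)%:E by rewrite lee_fin ltW// dual_weight_gt0.
    have mEs : measurable_fun setT (fun x => (dual_weight p w x)%:E).
      exact/measurable_EFinP.
    (* Each admissible [K] comes with its own versions [g'] and [h']; a.e. uniqueness refers its
       bound to the fixed [g] and [h]. *)
    have gg' := condexp_le_ae (sF 0%N) (@FM 0%N) sfF w0' mEw w0' mEw gP gP'
      (aeW mu (fun x => lexx _)).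
    have hh' := condexp_le_ae (sF 0%N) (@FM 0%N) sfF s0' mEs s0' mEs hP hP'
      (aeW mu (fun x => lexx _)).
    apply: filterS3 gg' hh' gh' => x gx hx ghx.
    apply: (@le_trans _ _ K%:E); last by rewrite lee_fin ltW.
    apply: le_trans ghx; apply: lee_pmul => //; first exact: poweR_ge0.
    exact: le_poweR2r.
  apply: filterS3 gpos hpos small => x gx hx smallx.
  have y0 : 0 < g x * poweR (h x) (p - 1) by rewrite mule_gt0// poweR_gt0.
  move: (g x * _) y0 smallx => [y| |] // y0 ys; last by have := ys 0%N.
  rewrite lte_fin in y0.
  have := ys (Num.truncn y^-1)%R; rewrite lee_fin leNgt => /negP; apply.
  by rewrite invf_plt ?posrE// truncnS_gt.
have dlAp : dl%:E <= Ap_char mu F p w.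
  by apply: le_ereal_inf_tmp => _ [K KP <-]; rewrite lee_fin; exact: dlK.
have Apf : Ap_char mu F p w \is a fin_num.
  rewrite ge0_fin_numE//; apply: le_trans dlAp; rewrite lee_fin; exact: ltW.
exists (fine (Ap_char mu F p w)); last by rewrite fineK.
by rewrite -lte_fin fineK//; apply: lt_le_trans dlAp; rewrite lte_fin.
Qed.

End Ap_char.

Unset Implicit Arguments. Set Strict Implicit.

Theorem theoremA1 (R : realType) (p : R) (hp : 1 < p) :
  exists C : R, 0 < C /\
  forall (d : measure_display) (T : measurableType d)
    (mu : {measure set T -> \bar R}) (F : nat -> set (set T)) (w : T -> R),
    is_filtration mu F ->
    is_weight mu w ->
    (Ap_char mu F p w < +oo)%E ->
    exists w1 w2 : T -> R,
      [/\ is_weight mu w1, is_weight mu w2,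
          {ae mu, forall x, w x = w1 x * w2 x `^ (1 - p)},
          (A1_char mu F w1 <= C%:E * Ap_char mu F p w)%E
        & (A1_char mu F w2 <= C%:E * poweR (Ap_char mu F p w) (1 / (p - 1)))%E].
Proof.
pose r := p - 1; have r0 : 0 < r by rewrite subr_gt0.
pose e := rdf_eps p; have e0 : 0 < e by exact: rdf_eps_gt0.
have er2 : 0 < (e `^ r) ^+ 2 by rewrite exprn_gt0// powR_gt0.
have ee2 : 0 < e ^+ 2 by rewrite exprn_gt0.
(* The denominators are the losses in the two A_1 bounds. The numerators pay for using an admissible
   constant below twice the characteristic. *)
pose C1 := 2 / (e `^ r) ^+ 2; pose C2 := 2 `^ r^-1 / e ^+ 2.
have C10 : 0 < C1 by rewrite divr_gt0.
have C20 : 0 < C2 by rewrite divr_gt0// powR_gt0.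
exists (C1 + C2); split; first by rewrite addr_gt0.
move=> d T mu F w [sF FM FS _ [S [SP ST]]] [w0 mw _] Aplty.
have sfF : sigma_fin mu (F 0%N).
  exact: filtration_sigma_fin (sF 0%N) (@FM 0%N) SP ST.
have [mu0|mu0] := pselect {ae mu, forall x : T, False}.
  exact: factorization_null sF FM _ _ mu0.
have [Q Q0 QE] : exists2 Q : R, 0 < Q & Ap_char mu F p w = Q%:E.
  exact: Ap_char_gt0 sF FM sfF hp w0 mw mu0 Aplty.
(* The infimum [Q] need not be known to be attained; since [Q > 0], some admissible [K] lies below
   [2 * Q]. *)
have [K [K0 KQ HK]] : exists K : R, [/\ 0 < K, K < 2 * Q & forall n, exists g h : T -> \bar R,
    [/\ is_condexp mu (F n) (fun x => (w x)%:E) g,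
        is_condexp mu (F n) (fun x => (w x `^ (1 / (1 - p)))%:E) h
      & {ae mu, forall x, (g x * poweR (h x) (p - 1) <= K%:E)%E}]].
  have : (Ap_char mu F p w < (2 * Q)%:E)%E.
    by rewrite QE lte_fin; lra.
  move=> /ereal_inf_lt[_ [K KP <-]]; rewrite lte_fin => KQ; exists K; split => //.
  have : (Ap_char mu F p w <= K%:E)%E by apply: ereal_inf_lbound; exists K.
  by rewrite QE lee_fin; exact: lt_le_trans.
have /choice[g gP'] := HK; have /choice[h ghP] := gP'.
have [w1 [w2 [ww1 ww2 wE A1 A2]]] := factorization_of_bound sF FM FS sfF hp w0 mw K0
  (fun n => let: And3 a _ _ := ghP n in a)
  (fun n => let: And3 _ b _ := ghP n in b)
  (fun n => let: And3 _ _ c := ghP n in c).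
exists w1, w2; split => //; first exact: aeW.
- apply: le_trans A1 _; rewrite QE -EFinM lee_fin.
  apply: (@le_trans _ _ (C1 * Q)); last by rewrite ler_wpM2r ?(ltW Q0)// lerDl ltW.
  by rewrite /C1 mulrAC ler_wpM2r ?invr_ge0 ?(ltW er2)// ltW.
- apply: le_trans A2 _; rewrite QE poweR_EFin -EFinM lee_fin div1r.
  apply: (@le_trans _ _ (C2 * Q `^ r^-1)); last first.
    by rewrite ler_wpM2r ?powR_ge0// lerDr ltW.
  rewrite /C2 mulrAC ler_wpM2r ?invr_ge0 ?(ltW ee2)// -powRM ?(ltW Q0)//.
  by apply: ge0_ler_powR; rewrite ?nnegrE ?invr_ge0 ?(ltW r0) ?(ltW K0) ?(ltW KQ)// mulr_ge0// ltW.
Qed.
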